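(* Let $f:\mathbb{R}^n\to\mathbb{R}$ be continuously differentiable and bounded from below, and suppose (A1): $\nabla f$ is Lipschitz continuous on $\mathbb{R}^n$ with constant $L>0$. Let $m\ge1$ be an integer and let $\{x^k\}_k$ be generated by the globalized Anderson acceleration scheme with restarting (see context) with memory parameter $m$ and parameters $\gamma,c_1,c_3>0$, $0<c_2<\frac{1}{2mL}$, and $\nu\in(2,3)$. Then $$\sum_{k=0}^\infty\|\nabla f(x^k)\|^2<\infty\qquad\text{and}\qquad \lim_{k\to\infty}\|\nabla f(x^k)\|=0.$$ In addition, suppose that $\gamma<\frac1{2L}$, that $x^\star$ is an accumulation point of $\{x^{k(m+1)}\}_k$ with $\nabla f(x^\star)=0$, and that for some $r,\mu>0$: (A2) $f$ is $\mu$-strongly convex on $\mathbb{B}_r(x^\star)$; (A3) $\nabla^2 f$ exists and is Lipschitz continuous on $\mathbb{B}_r(x^\star)$; and there is $M>0$ such that the condition number of $X_k^\top X_k$ is bounded by $M^2$ for every $k\in\mathbb{N}$. Then $x^k\to x^\star$ and all Anderson acceleration steps are eventually accepted, i.e., there is $K$ such that for all $k\ge K$ with $\mathrm{mod}(k,m+1)\neq0$ one has $x^{k+1}=x^k_{\mathsf{AA}}$ (so that the scheme locally turns into the non-globalized Anderson acceleration with restarting).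
   Context: $\mathbb{B}_r(x^\star)=\{x:\|x-x^\star\|<r\}$; $\|\cdot\|$ is the Euclidean norm. Define $g(x)=x-\frac1L\nabla f(x)$, $h(x)=g(x)-x$, $g^k=g(x^k)$, $h^k=h(x^k)$. For a sequence $\{x^k\}$ and an index $k$ put $\hat m=\mathrm{mod}(k,m+1)$ and $X_k=[x^{k-\hat m+1}-x^{k-\hat m},\dots,x^k-x^{k-\hat m}]$, $H_k=[h^{k-\hat m+1}-h^{k-\hat m},\dots,h^k-h^{k-\hat m}]$, $G_k=[g^{k-\hat m+1}-g^{k-\hat m},\dots,g^k-g^{k-\hat m}]$ in $\mathbb{R}^{n\times\hat m}$. The condition number is $\kappa(A)=\sigma_{\max}(A)/\sigma_{\min}(A)$ ($+\infty$ if $\sigma_{\min}(A)=0$); conditions on $X_k$ are void when $\hat m=0$. Globalized AA scheme with restarting: given $x^0\in\mathbb{R}^n$, $m$ and $\gamma,\nu,c_1,c_2,c_3>0$, for $k=0,1,\dots$ let $\hat m=\mathrm{mod}(k,m+1)$. If $\hat m=0$, set $x^{k+1}=g(x^k)$. Otherwise let $\alpha^k\in\mathbb{R}^{\hat m}$ be a solution of $\min_\alpha\|h^{k-\hat m}+H_k\alpha\|^2$ and set $x^k_{\mathsf{AA}}=g^{k-\hat m}+G_k\alpha^k$. If $$f(x^k_{\mathsf{AA}})\le f(x^k)-\gamma\|\nabla f(x^k)\|^2+\min\{c_1\|\nabla f(x^{k-\hat m})\|^\nu,\;c_2\|\nabla f(x^{k-\hat m})\|^2,\;c_3\},$$ the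 Anderson acceleration step is accepted and $x^{k+1}=x^k_{\mathsf{AA}}$; otherwise $x^{k+1}=g(x^k)$. The non-globalized Anderson acceleration with restarting is the same scheme in which $x^{k+1}=x^k_{\mathsf{AA}}$ is always taken when $\hat m\ne0$. *)

(* Defs.v *)
From HB Require Import structures.
From mathcomp Require Import all_boot all_order all_algebra.
From mathcomp Require Import all_classical all_reals all_analysis.

Set Implicit Arguments.
Unset Strict Implicit.
Unset Printing Implicit Defensive.
Import Order.TTheory GRing.Theory Num.Theory.
Import numFieldNormedType.Exports.
Local Open Scope classical_set_scope.
Local Open Scope ring_scope.

(* The library norm on 'cV[R]_n is the entrywise max norm, so the Euclidean norm
   is defined here; the topology, hence limits, clusters and differentiability,
   is the same. *)

Section Euclidean.
Context {R : realType}.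

Definition enorm n (x : 'cV[R]_n) : R := Num.sqrt (\sum_(i < n) x i 0 ^+ 2).

Definition eball n (c : 'cV[R]_n) (r : R) : set 'cV[R]_n :=
  [set y | enorm (y - c) < r].

(* Matrix norm induced by the Euclidean norm. *)
Definition opnorm p q (A : 'M[R]_(p, q)) : R :=
  sup [set enorm (A *m v) | v in [set v : 'cV[R]_q | enorm v <= 1]].

Definition singular_values n (A : 'M[R]_n) : set R :=
  [set s | 0 <= s /\ eigenvalue (A^T *m A) (s ^+ 2)].

Definition sigma_max n (A : 'M[R]_n) : R := sup (singular_values A).

Definition sigma_min n (A : 'M[R]_n) : R := inf (singular_values A).

Definition cond_number n (A : 'M[R]_n) : \bar R :=
  if sigma_min A == 0 then +oo%E else (sigma_max A / sigma_min A)%:E.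

End Euclidean.

Section Calculus.
Context {R : realType} {n : nat}.
Implicit Types (f : 'cV[R]_n -> R) (A : set 'cV[R]_n).

(* Vector of partial derivatives. *)
Definition grad f (x : 'cV[R]_n) : 'cV[R]_n :=
  \col_i 'D_(delta_mx i 0) f x.

Definition hessian f (x : 'cV[R]_n) : 'M[R]_n :=
  \matrix_(i, j) 'D_(delta_mx j 0) (fun y => grad f y i 0) x.

Definition continuously_differentiable f : Prop :=
  (forall x, differentiable f x) /\ continuous (grad f).

Definition lipschitz_gradient f (L : R) : Prop :=
  forall x y, enorm (grad f x - grad f y) <= L * enorm (x - y).

Definition strongly_convex_on A f (mu : R) : Prop :=
  forall x y, A x -> A y -> forall t : R, 0 <= t <= 1 ->
    f ((1 - t) *: x + t *: y) <=
      (1 - t) * f x + t * f y - mu / 2 * t * (1 - t) * enorm (x - y) ^+ 2.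

(* [grad f] is Frechet differentiable at every point of A, and its derivative
   is Lipschitz on A. *)
Definition lipschitz_hessian_on A f : Prop :=
  (forall x, A x -> differentiable (grad f) x) /\
  exists K : R, forall x y, A x -> A y ->
    opnorm (hessian f x - hessian f y) <= K * enorm (x - y).

End Calculus.

Section Anderson.
Context {R : realType} {n : nat}.
Variables (f : 'cV[R]_n -> R) (L : R) (m : nat).

Definition gstep (x : 'cV[R]_n) : 'cV[R]_n := x - L^-1 *: grad f x.

Definition hres (x : 'cV[R]_n) : 'cV[R]_n := gstep x - x.

Definition mhat (k : nat) : nat := (k %% m.+1)%N.

(* [u^{k-mhat+1} - u^{k-mhat}, ..., u^k - u^{k-mhat}]; column j : 'I_(mhat k) is
   0-based, whence the j.+1. *)
Definition diffmx (u : nat -> 'cV[R]_n) (k : nat) : 'M[R]_(n, mhat k) :=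
  \matrix_(i, j) (u (k - mhat k + j.+1)%N - u (k - mhat k)%N) i 0.

Variable x : nat -> 'cV[R]_n.

Definition Xmx (k : nat) : 'M[R]_(n, mhat k) := diffmx x k.
Definition Hmx (k : nat) : 'M[R]_(n, mhat k) := diffmx (fun i => hres (x i)) k.
Definition Gmx (k : nat) : 'M[R]_(n, mhat k) := diffmx (fun i => gstep (x i)) k.

Definition ls_solution (k : nat) (a : 'cV[R]_(mhat k)) : Prop :=
  forall b : 'cV[R]_(mhat k),
    enorm (hres (x (k - mhat k)%N) + Hmx k *m a) ^+ 2 <=
    enorm (hres (x (k - mhat k)%N) + Hmx k *m b) ^+ 2.

Variable alpha : forall k, 'cV[R]_(mhat k).

Definition xAA (k : nat) : 'cV[R]_n :=
  gstep (x (k - mhat k)%N) + Gmx k *m alpha k.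

Variables gamma nu c1 c2 c3 : R.

Definition AA_accept (k : nat) : bool :=
  let d := enorm (grad f (x (k - mhat k)%N)) in
  f (xAA k) <= f (x k) - gamma * enorm (grad f (x k)) ^+ 2
               + Num.min (c1 * d `^ nu) (Num.min (c2 * d ^+ 2) c3).

(* x is generated by the globalized scheme, alpha being the least-squares
   solutions selected along the way (the solution need not be unique). *)
Definition globalized_AA : Prop :=
  forall k,
    (mhat k = 0%N -> x k.+1 = gstep (x k)) /\
    (mhat k <> 0%N ->
       ls_solution (alpha k) /\
       x k.+1 = if AA_accept k then xAA k else gstep (x k)).

End Anderson.

(* Main.v *)
Require Import Defs.
From HB Require Import structures.
From mathcomp Require Import all_boot all_order all_algebra.
From mathcomp Require Import all_classical all_reals all_analysis.
From mathcomp Require Import ring lra.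

Set Implicit Arguments.
Unset Strict Implicit.
Unset Printing Implicit Defensive.
Import Order.TTheory GRing.Theory Num.Theory.
Import numFieldNormedType.Exports.
Local Open Scope classical_set_scope.
Local Open Scope ring_scope.

(** Fix a restart block starting at x^p and write d for the norm of grad f (x^p).

    Summability.  A gradient step lowers f by |grad f|^2 / (2L); an accepted
    accelerated step lowers it by gamma |grad f|^2 up to an allowance of at most
    c2 d^2.  A block contains at most m accelerated steps and m c2 < 1/(2L), so
    the gradient step opening the block pays in advance for all its allowances.
    [potential] keeps that account; it drops by a fixed multiple of
    |grad f (x^k)|^2 at every step ([potential_decrease]), and f is bounded below.

    Local acceptance.  Let A be the Hessian at xs and D = |x^p - xs|.  Step j of
    the block forms y_j = x^p + X alpha and the residual
    rho_j = grad f (x^p) + (gradient differences) alpha of least norm, and its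
    accelerated point is y_j - rho_j / L.  The bound on the condition number
    excludes cancellation in X alpha, so that y_j - xs = O(D) and
    rho_j = A (y_j - xs) + O(D^2) ([radius_step]).  If the earlier steps of the
    block were accepted, one is thus running MINRES for A up to errors O(D^2),
    and the point is that function values, not only residuals, decrease.  What
    has to be shown is rho_j . (x^{p+j} - y_j) >= - O(D^3) ([minres_progress]).
    Minimality gives rho_j . rho_i = |rho_j|^2 for i <= j, hence for each v in the
    search space one number s satisfies both rho_j . v = s |rho_j|^2 and
    rho_{j-1} . v = s |rho_{j-1}|^2 ([averaged_common_ratio]).  For
    v = t = y_{j-1} - y_j,
      (|rho_{j-1}|^2 - |rho_j|^2) s = (rho_{j-1} - rho_j) . t ~ t . A t
        >= |A t|^2 / L ~ (|rho_{j-1}|^2 - |rho_j|^2) / L,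
    so s >= 1/L up to errors, while
    rho_j . (x^{p+j} - y_j) = |rho_j|^2 (s - 1/L).  The residual contracts
    geometrically, so that division by |rho_{j-1}|^2 - |rho_j|^2 costs only a
    constant ([scalar_progress]).  Expanding the quadratic model of f then gives
      f (x_AA) <= f (x^{p+j}) - |grad f (x^{p+j})|^2 / (2L) + O(D^3)
    ([accelerated_step_descent], [block_descent]).  Since D = O(d) and nu < 3, the
    error is below the allowance ([cubic_below_threshold]): the step is accepted,
    and the induction along the block continues ([block_acceptance]).

    Convergence.  f does not increase from one block start to the next, it grows
    quadratically around xs, and a block starting at distance D stays within C D of
    xs.  Hence once a block starts close enough to xs no later block start
    leaves the corresponding sublevel neighbourhood, and grad f (x^k) -> 0 forces
    D -> 0 ([local_convergence]). *)

(** * Euclidean norm and inner product *)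

Section EuclideanGeometry.
Context {R : realType}.

Definition dot n (u v : 'cV[R]_n) : R := \sum_(i < n) u i 0 * v i 0.

Lemma dotC n (u v : 'cV[R]_n) : dot u v = dot v u.
Proof. by apply: eq_bigr => i _; rewrite mulrC. Qed.

Lemma dotDl n (u v w : 'cV[R]_n) : dot (u + v) w = dot u w + dot v w.
Proof. by rewrite -big_split; apply: eq_bigr => i _; rewrite mxE mulrDl. Qed.

Lemma dotZl n (a : R) (u v : 'cV[R]_n) : dot (a *: u) v = a * dot u v.
Proof. by rewrite mulr_sumr; apply: eq_bigr => i _; rewrite mxE mulrA. Qed.

Lemma dotNl n (u v : 'cV[R]_n) : dot (- u) v = - dot u v.
Proof. by rewrite -scaleN1r dotZl mulN1r. Qed.

Lemma dotBl n (u v w : 'cV[R]_n) : dot (u - v) w = dot u w - dot v w.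
Proof. by rewrite dotDl dotNl. Qed.

Lemma dotDr n (u v w : 'cV[R]_n) : dot w (u + v) = dot w u + dot w v.
Proof. by rewrite dotC dotDl !(dotC w). Qed.

Lemma dotZr n (a : R) (u v : 'cV[R]_n) : dot u (a *: v) = a * dot u v.
Proof. by rewrite dotC dotZl dotC. Qed.

Lemma dotNr n (u v : 'cV[R]_n) : dot u (- v) = - dot u v.
Proof. by rewrite dotC dotNl dotC. Qed.

Lemma dotBr n (u v w : 'cV[R]_n) : dot w (u - v) = dot w u - dot w v.
Proof. by rewrite dotDr dotNr. Qed.

Lemma dot0l n (u : 'cV[R]_n) : dot 0 u = 0.
Proof. by rewrite -(scale0r 0) dotZl mul0r. Qed.

Lemma dot0r n (u : 'cV[R]_n) : dot u 0 = 0.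
Proof. by rewrite dotC dot0l. Qed.

Lemma dot_sumr n (u : 'cV[R]_n) I (r : seq I) (P : pred I) (F : I -> 'cV[R]_n) :
  dot u (\sum_(i <- r | P i) F i) = \sum_(i <- r | P i) dot u (F i).
Proof.
by elim/big_rec2: _ => [|i y1 y2 _ <-]; rewrite ?dot0r ?dotDr.
Qed.

Lemma dot_trmx p q (A : 'M[R]_(p, q)) u v : dot (A *m u) v = dot u (A^T *m v).
Proof.
have E k (a b : 'cV[R]_k) : dot a b = (a^T *m b) 0 0.
  by rewrite mxE; apply: eq_bigr => i _; rewrite mxE.
by rewrite !E trmx_mul mulmxA.
Qed.

Definition dot_expand := (dotDl, dotDr, dotNl, dotNr, dotZl, dotZr).

Lemma dotvv_ge0 n (u : 'cV[R]_n) : 0 <= dot u u.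
Proof. by apply: sumr_ge0 => i _; rewrite -expr2 sqr_ge0. Qed.

Lemma enorm_ge0 n (u : 'cV[R]_n) : 0 <= enorm u.
Proof. exact: sqrtr_ge0. Qed.

Lemma enorm_sq n (u : 'cV[R]_n) : enorm u ^+ 2 = dot u u.
Proof.
rewrite sqr_sqrtr; last by apply: sumr_ge0 => i _; exact: sqr_ge0.
by apply: eq_bigr => i _; rewrite expr2.
Qed.

Lemma enormE n (u : 'cV[R]_n) : enorm u = Num.sqrt (dot u u).
Proof. by rewrite -enorm_sq sqrtr_sqr ger0_norm ?enorm_ge0. Qed.

Lemma enorm0 n : enorm (0 : 'cV[R]_n) = 0.
Proof. by rewrite enormE dot0l sqrtr0. Qed.

Lemma enorm_eq0 n (u : 'cV[R]_n) : (enorm u == 0) = (u == 0).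
Proof.
apply/eqP/eqP => [u0|->]; last exact: enorm0.
have : dot u u == 0 by rewrite -enorm_sq u0 expr0n.
rewrite psumr_eq0; last by move=> i _; rewrite -expr2 sqr_ge0.
move=> /allP ui; apply/matrixP => i j; rewrite ord1 mxE.
have := ui i (mem_index_enum i).
by rewrite /= mulf_eq0 orbb => /eqP.
Qed.

Lemma enormZ n (a : R) (u : 'cV[R]_n) : enorm (a *: u) = `|a| * enorm u.
Proof.
by rewrite !enormE dotZl dotZr mulrA -expr2 sqrtrM ?sqr_ge0// sqrtr_sqr.
Qed.

Lemma enormN n (u : 'cV[R]_n) : enorm (- u) = enorm u.
Proof. by rewrite -scaleN1r enormZ normrN1 mul1r. Qed.

Lemma enormBC n (u v : 'cV[R]_n) : enorm (u - v) = enorm (v - u).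
Proof. by rewrite -enormN opprB. Qed.

Lemma CauchySchwarz n (u v : 'cV[R]_n) : `|dot u v| <= enorm u * enorm v.
Proof.
have [->|v0] := eqVneq v 0; first by rewrite dot0r enorm0 mulr0 normr0.
have vv : 0 < dot v v by rewrite -enorm_sq exprn_gt0// lt0r enorm_eq0 v0 enorm_ge0.
rewrite -(@ler_pXn2r _ 2)// ?nnegrE ?mulr_ge0 ?enorm_ge0//.
rewrite exprMn !enorm_sq real_normK ?num_real//.
have := dotvv_ge0 (dot v v *: u - dot u v *: v).
rewrite !dot_expand (dotC v u) => H.
rewrite -subr_ge0 -(pmulr_rge0 _ vv).
by apply: le_trans H _; rewrite le_eqVlt; apply/orP; left; apply/eqP; ring.
Qed.

Lemma dot_le n (u v : 'cV[R]_n) : dot u v <= enorm u * enorm v.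
Proof. exact: le_trans (ler_norm _) (CauchySchwarz u v). Qed.

Lemma enormD n (u v : 'cV[R]_n) : enorm (u + v) <= enorm u + enorm v.
Proof.
rewrite -(@ler_pXn2r _ 2)// ?nnegrE ?addr_ge0 ?enorm_ge0//.
rewrite sqrrD !enorm_sq !dot_expand (dotC v u).
have := dot_le u v; lra.
Qed.

Lemma enormB n (u v : 'cV[R]_n) : enorm (u - v) <= enorm u + enorm v.
Proof. by rewrite -(enormN v) enormD. Qed.

Lemma enorm_le_sub n (u v : 'cV[R]_n) : enorm u <= enorm v + enorm (v - u).
Proof. by rewrite -{1}(subKr v u) enormB. Qed.

Lemma enorm_sum n I (r : seq I) (P : pred I) (F : I -> 'cV[R]_n) :
  enorm (\sum_(i <- r | P i) F i) <= \sum_(i <- r | P i) enorm (F i).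
Proof.
elim/big_rec2: _ => [|i y1 y2 _ h]; first by rewrite enorm0.
exact: le_trans (enormD _ _) (lerD _ _).
Qed.

Lemma norm_coord_le n (u : 'cV[R]_n) i : `|u i 0| <= enorm u.
Proof.
rewrite -(@ler_pXn2r _ 2)// ?nnegrE ?enorm_ge0//.
rewrite real_normK ?num_real// enorm_sq /dot (bigD1 i)//= -expr2 lerDl.
by apply: sumr_ge0 => j _; rewrite -expr2 sqr_ge0.
Qed.

Lemma enorm_le_sum n (u : 'cV[R]_n) : enorm u <= \sum_i `|u i 0|.
Proof.
have {1}-> : u = \sum_i u i 0 *: delta_mx i 0.
  by rewrite {1}(matrix_sum_delta u); apply: eq_bigr => i _; rewrite big_ord1.
apply: le_trans (enorm_sum _ _ _) _; apply: ler_sum => i _.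
rewrite enormZ enormE /dot (bigD1 i)//= big1 ?mxE ?eqxx ?mulr1 ?addr0 ?sqrtr1 ?mulr1//.
by move=> j /negPf ji; rewrite mxE ji mul0r.
Qed.

(** The entrywise sum of absolute values; only the existence of some Lipschitz
    constant matters. *)
Lemma mulmx_bound p q (A : 'M[R]_(p, q)) :
  exists2 C, 0 < C & forall v, enorm (A *m v) <= C * enorm v.
Proof.
exists (1 + \sum_i \sum_j `|A i j|) => [|v].
  by rewrite ltr_wpDr//; do 2![apply: sumr_ge0 => ? _].
apply: le_trans (enorm_le_sum _) _.
rewrite mulrDl mul1r ler_wpDl ?enorm_ge0// mulr_suml; apply: ler_sum => i _.
rewrite mxE mulr_suml; apply: le_trans (ler_norm_sum _ _ _) _.
by apply: ler_sum => j _; rewrite normrM ler_wpM2l ?norm_coord_le.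
Qed.

(** Links the supremum defining [opnorm] to individual vectors; [mulmx_bound]
    makes the supremum finite. *)
Lemma opnorm_bound p q (A : 'M[R]_(p, q)) v : enorm (A *m v) <= opnorm A * enorm v.
Proof.
have [->|v0] := eqVneq v 0; first by rewrite mulmx0 !enorm0 mulr0.
have ev : 0 < enorm v by rewrite lt0r enorm_eq0 v0 enorm_ge0.
rewrite -ler_pdivrMr//; apply: sup_ubound.
  have [C C0 hC] := mulmx_bound A; exists C => _ [w w1 <-].
  by apply: le_trans (hC w) _; rewrite ger_pMr.
exists ((enorm v)^-1 *: v) => /=.
  by rewrite enormZ ger0_norm ?invr_ge0 ?enorm_ge0// mulVf ?gt_eqF.
by rewrite -scalemxAr enormZ ger0_norm ?invr_ge0 ?enorm_ge0// mulrC.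
Qed.

(** With [mx_norm_le_enorm], this identifies the topology of the library norm
    with the Euclidean one. *)
Lemma enorm_le_mx_norm n (u : 'cV[R]_n) : enorm u <= n%:R * `|u|.
Proof.
apply: le_trans (enorm_le_sum u) _.
have -> : n%:R * `|u| = \sum_(i < n) `|u|.
  by rewrite sumr_const card_ord mulr_natl.
apply: ler_sum => i _; rewrite [leRHS]mx_normrE.
exact: (le_bigmax _ (fun k : 'I_n * 'I_1 => `|u k.1 k.2|) (i, 0)).
Qed.

Lemma mx_norm_le_enorm n (u : 'cV[R]_n) : `|u| <= enorm u.
Proof.
rewrite [leLHS]mx_normrE; apply: bigmax_le; first exact: enorm_ge0.
by case=> i j _ /=; rewrite ord1 norm_coord_le.
Qed.

End EuclideanGeometry.

(** * Symmetric matrices, Rayleigh quotients and condition numbers *)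

Section SymmetricMatrices.
Context {R : realType}.

(** Positivity of the form at v - (B v) / C, where the cubic term (B v) . B (B
    v) is at most C |B v|^2.  For C a Lipschitz constant this is the sharp
    cocoercivity that a spectral decomposition would give. *)
Lemma psd_cocoercive n (B : 'M[R]_n) (C : R) :
  B^T = B -> (forall v, 0 <= dot v (B *m v)) -> 0 < C ->
  (forall v, enorm (B *m v) <= C * enorm v) ->
  forall v, enorm (B *m v) ^+ 2 <= C * dot v (B *m v).
Proof.
move=> symB psdB C0 hC v.
have := psdB (v - C^-1 *: (B *m v)).
rewrite mulmxBr -scalemxAr !dot_expand -!enorm_sq.
have -> : dot v (B *m (B *m v)) = enorm (B *m v) ^+ 2.
  by rewrite enorm_sq dot_trmx symB.
set b := enorm (B *m v) ^+ 2; set a := dot v _; set c := dot (B *m v) _.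
have cb : c <= C * b.
  apply: le_trans (dot_le _ _) _; rewrite /b expr2 mulrCA.
  by rewrite ler_wpM2l ?enorm_ge0.
move=> H; have E : 0 <= a - C^-1 * b.
  apply: le_trans H _.
  have : C^-1 * (C^-1 * c) <= C^-1 * b.
    by rewrite ler_wpM2l ?invr_ge0 ?(ltW C0)// mulrC ler_pdivrMr// mulrC.
  lra.
have := ler_wpM2l (ltW C0) E.
by rewrite mulr0 mulrBr mulrA divff ?gt_eqF// mul1r subr_ge0.
Qed.

(** The infimum a of the Rayleigh quotient is an eigenvalue: otherwise B - a
    would be invertible, and [psd_cocoercive] applied to the positive
    semidefinite B - a would bound its form away from zero on the unit sphere. *)
Lemma min_rayleigh_eigenvalue n (B : 'M[R]_n) : (0 < n)%N -> B^T = B ->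
  exists2 a : R, eigenvalue B a & forall v, a * enorm v ^+ 2 <= dot v (B *m v).
Proof.
move=> n0 symB.
have [C C0 hC] := mulmx_bound B.
pose S := [set dot v (B *m v) | v in [set v : 'cV[R]_n | enorm v = 1]].
have lbS : has_lbound S.
  exists (- C) => _ [v v1 <-]; rewrite lerNl.
  apply: le_trans (ler_norm _) _; rewrite normrN.
  apply: le_trans (CauchySchwarz _ _) _.
  by have := hC v; rewrite v1 !mul1r mulr1.
have infS : has_inf S.
  split=> //; pose e : 'cV[R]_n := delta_mx (Ordinal n0) 0.
  exists (dot e (B *m e)), e => //=.
  rewrite enormE /dot (bigD1 (Ordinal n0))//= big1 ?mxE ?eqxx ?mulr1 ?addr0 ?sqrtr1//.
  by move=> j /negPf ji; rewrite mxE ji mul0r.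
pose a := inf S; have aB v : a * enorm v ^+ 2 <= dot v (B *m v).
  have [->|v0] := eqVneq v 0; first by rewrite enorm0 dot0l expr0n mulr0.
  have ev : 0 < enorm v by rewrite lt0r enorm_eq0 v0 enorm_ge0.
  have : a <= dot ((enorm v)^-1 *: v) (B *m ((enorm v)^-1 *: v)).
    apply: ge_inf => //; exists ((enorm v)^-1 *: v) => //=.
    by rewrite enormZ ger0_norm ?invr_ge0 ?enorm_ge0// mulVf ?gt_eqF.
  rewrite -scalemxAr !dot_expand mulrA -invfM -expr2 mulrC ler_pdivlMr//.
  by rewrite exprn_gt0.
exists a => //; apply: contraT => noteig.
pose N := B - a%:M.
have symN : N^T = N by rewrite /N linearB /= symB tr_scalar_mx.
have NE v : dot v (N *m v) = dot v (B *m v) - a * enorm v ^+ 2.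
  by rewrite mulmxBl dotBr mul_scalar_mx dotZr enorm_sq.
have psdN v : 0 <= dot v (N *m v) by rewrite NE subr_ge0.
have unitN : N \in unitmx.
  by rewrite -row_free_unit -kermx_eq0; move: noteig; rewrite negbK.
have [C1 C10 hC1] := mulmx_bound N.
have [C2 C20 hC2] := mulmx_bound (invmx N).
have coN := psd_cocoercive symN psdN C10 hC1.
have gap v : enorm v = 1 -> (C2 ^+ 2 * C1)^-1 + a <= dot v (B *m v).
  move=> v1; have := hC2 (N *m v); rewrite mulKmx// v1 => h1.
  have h2 : 1 <= C2 ^+ 2 * enorm (N *m v) ^+ 2.
    by rewrite -exprMn exprn_ege1.
  have h3 : 1 <= C2 ^+ 2 * C1 * dot v (N *m v).
    apply: le_trans h2 _; rewrite -mulrA ler_wpM2l ?sqr_ge0//.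
  rewrite -lerBrDr -[leLHS]mul1r ler_pdivrMr ?mulr_gt0 ?exprn_gt0// mulrC.
  by move: h3; rewrite NE v1 expr1n mulr1.
have : (C2 ^+ 2 * C1)^-1 + a <= a.
  by apply: lb_le_inf => [|_ [v v1 <-]]; [case: infS|exact: gap].
by rewrite gerDr leNgt invr_gt0 mulr_gt0// exprn_gt0.
Qed.

Lemma max_rayleigh_eigenvalue n (B : 'M[R]_n) : (0 < n)%N -> B^T = B ->
  exists2 a : R, eigenvalue B a & forall v, dot v (B *m v) <= a * enorm v ^+ 2.
Proof.
move=> n0 symB.
have [|a /eigenvalueP[w wE w0] ha] := @min_rayleigh_eigenvalue _ (- B) n0.
  by rewrite linearN /= symB.
exists (- a) => [|v].
  by apply/eigenvalueP; exists w => //; rewrite scaleNr -wE mulmxN opprK.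
by have := ha v; rewrite mulNmx dotNr mulNr lerNr.
Qed.

Lemma eigenvalue_singular n (B : 'M[R]_n) a :
  B^T = B -> 0 <= a -> eigenvalue B a -> singular_values B a.
Proof.
move=> symB a0 /eigenvalueP[w wE w0]; split=> //.
apply/eigenvalueP; exists w => //.
by rewrite symB mulmxA wE -scalemxAl wE scalerA expr2.
Qed.

Lemma singular_values_ub n (B : 'M[R]_n) : has_ubound (singular_values B).
Proof.
have [C C0 hC] := mulmx_bound (B^T *m B)^T.
exists (C + 1) => s [s0 /eigenvalueP[w wE w0]].
have w'0 : w^T != 0 by rewrite -(inj_eq trmx_inj) trmxK linear0.
have := hC w^T; rewrite -trmx_mul wE linearZ /= enormZ.
rewrite ler_pM2r ?lt0r ?enorm_eq0 ?w'0 ?enorm_ge0//.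
rewrite ger0_norm ?sqr_ge0// => h; rewrite leNgt; apply/negP => h2.
have := ltr_pM (ltW (ltr_wpDr ler01 C0)) _ h2 h2; nra.
Qed.

(** The largest and smallest Rayleigh quotients of the Gram matrix are
    eigenvalues, hence singular values since it is positive semidefinite.
    Therefore |X_j|^2 <= sigma_max <= M^2 sigma_min and sigma_min |a|^2 <= |X
    a|^2. *)
Lemma cond_number_gram p q (X : 'M[R]_(p, q)) (M : R) : (0 < q)%N ->
  (cond_number (X^T *m X) <= (M ^+ 2)%:E)%E ->
  forall j a, enorm (col j X) * enorm a <= `|M| * enorm (X *m a).
Proof.
move=> q0; set B := X^T *m X => hM j a.
have symB : B^T = B by rewrite /B trmx_mul trmxK.
have BE v : dot v (B *m v) = enorm (X *m v) ^+ 2.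
  by rewrite enorm_sq dot_trmx mulmxA.
have eigB s : eigenvalue B s -> 0 <= s.
  move=> /eigenvalueP[w wE w0].
  have w'0 : w^T != 0 by rewrite -(inj_eq trmx_inj) trmxK linear0.
  have : dot w^T (B *m w^T) = s * enorm w^T ^+ 2.
    by rewrite -{1}symB -trmx_mul wE linearZ /= dotZr enorm_sq.
  rewrite BE => h; rewrite -(@pmulr_lge0 _ (enorm w^T ^+ 2)) -?h ?sqr_ge0//.
  by rewrite exprn_gt0// lt0r enorm_eq0 w'0 enorm_ge0.
have [s es hs] := min_rayleigh_eigenvalue q0 symB.
have [t et ht] := max_rayleigh_eigenvalue q0 symB.
have s_min : sigma_min B <= s.
  apply: ge_inf; first by exists 0 => ? [].
  exact: eigenvalue_singular (eigB _ es) es.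
have t_max : t <= sigma_max B.
  apply: ub_le_sup; first exact: singular_values_ub.
  exact: eigenvalue_singular (eigB _ et) et.
move: hM; rewrite /cond_number; case: eqP => [_|/eqP m0].
  by rewrite leNgt ltey.
have min0 : 0 < sigma_min B.
  rewrite lt0r m0; apply: lb_le_inf; last by move=> ? [].
  by exists s; exact: eigenvalue_singular (eigB _ es) es.
rewrite lee_fin ler_pdivrMr// => hM.
rewrite -(@ler_pXn2r _ 2)// ?nnegrE ?mulr_ge0 ?enorm_ge0 ?normr_ge0//.
rewrite !exprMn real_normK ?num_real//.
have colX : enorm (col j X) ^+ 2 <= sigma_max B.
  have := ht (delta_mx j 0); rewrite BE -colE => /le_trans; apply.
  have -> : enorm (delta_mx j 0 : 'cV[R]_q) = 1.
    rewrite enormE /dot (bigD1 j)//= big1 ?mxE ?eqxx ?mulr1 ?addr0 ?sqrtr1//.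
    by move=> k /negPf kj; rewrite mxE kj mul0r.
  by rewrite expr1n mulr1.
have aX : sigma_min B * enorm a ^+ 2 <= enorm (X *m a) ^+ 2.
  by rewrite -BE; apply: le_trans (hs a); rewrite ler_wpM2r ?sqr_ge0.
apply: le_trans (ler_wpM2r (sqr_ge0 _) (le_trans colX hM)) _.
by rewrite -mulrA ler_wpM2l ?sqr_ge0.
Qed.

End SymmetricMatrices.

(** * Derivatives along lines and the quadratic upper bound *)

Section CalculusAlongLines.
Context {R : realType} {n : nat}.
Implicit Types (f : 'cV[R]_n -> R) (y v w : 'cV[R]_n).

Lemma is_derive_line f y v (t : R) : differentiable f (y + t *: v) ->
  is_derive t 1 (fun s : R => f (y + s *: v)) (dot (grad f (y + t *: v)) v).
Proof.
move=> df.
have E : (fun h : R => h^-1 *: (f (y + (h *: (1 : R) + t) *: v) - f (y + t *: v)))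
       = (fun h : R => h^-1 *: (f (h *: v + (y + t *: v)) - f (y + t *: v))).
  apply/funext => h; do 2 f_equal; congr f.
  by rewrite [h *: 1]mulr1 scalerDl addrCA.
have dv : derivable f (y + t *: v) v by exact: diff_derivable.
apply: DeriveDef; first by rewrite /derivable /= E.
rewrite /derive /= E -/(derive f (y + t *: v) v) deriveE//.
move: (y + t *: v) df dv {E} => z df dv.
rewrite {1}(matrix_sum_delta v) linear_sum; apply: eq_bigr => i _.
by rewrite big_ord1 linearZ /= mxE -deriveE// mulrC.
Qed.

(** Mean value theorem for phi minus the primitive a t + b t^2 / 2; the factor
    1/2 on the slope b is what makes the second-order expansions sharp. *)
Lemma increment_le (phi dphi : R -> R) (a b : R) :
  (forall t : R, 0 <= t <= 1 -> is_derive t (1 : R) phi (dphi t)) ->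
  (forall t : R, 0 <= t <= 1 -> dphi t <= a + b * t) ->
  phi 1 - phi 0 <= a + b / 2.
Proof.
move=> dphiE hdphi.
pose psi (t : R) := phi t - (a * t + b / 2 * t ^+ 2).
have dpsi (t : R) : 0 <= t <= 1 -> is_derive t (1 : R) psi (dphi t - (a + b * t)).
  move=> /dphiE ?; apply: is_derive_eq.
  rewrite /GRing.scale /=; by field.
have [|||c c01] := @MVT_segment _ psi (fun t => dphi t - (a + b * t)) 0 1.
- exact: ler01.
- by move=> u; rewrite in_itv/= => /andP[u0 u1]; apply: dpsi; rewrite !ltW.
- apply: derivable_within_continuous => u; rewrite in_itv/= => u01.
  by case: (dpsi _ u01).
rewrite subr0 mulr1 /psi; move: c01; rewrite in_itv/= => /hdphi hc; lra.
Qed.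

Lemma is_derive_sum_fun (h : 'I_n -> R -> R) (t : R) (dh : 'I_n -> R) :
  (forall i, is_derive t (1 : R) (h i) (dh i)) ->
  is_derive t (1 : R) (fun s => \sum_i h i s) (\sum_i dh i).
Proof.
move=> H; have -> : (fun s => \sum_i h i s) = \sum_i h i.
  by apply/funext => s; rewrite fct_sumE.
exact: is_derive_sum.
Qed.

Lemma is_derive_grad_line f y v w (t : R) :
  differentiable (grad f) (y + t *: v) ->
  is_derive t 1 (fun s : R => dot w (grad f (y + s *: v)))
    (dot w (hessian f (y + t *: v) *m v)).
Proof.
move=> dg; apply: is_derive_sum_fun => i.
have dgi : differentiable (fun z => grad f z i 0) (y + t *: v).
  by apply: (@differentiable_comp _ _ _ _ (grad f) (fun N : 'cV[R]_n => N i 0));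
    last exact: differentiable_coord.
have := is_derive_line dgi => dl.
apply: is_derive_eq; rewrite /GRing.scale /=; congr (_ * _).
rewrite /dot mxE; apply: eq_bigr => j _; by rewrite !mxE.
Qed.

Lemma gradient_quadratic_bound f (L : R) y v :
  (forall z, differentiable f z) -> lipschitz_gradient f L ->
  `|f (y + v) - f y - dot (grad f y) v| <= L / 2 * enorm v ^+ 2.
Proof.
move=> df lip.
pose phi (t : R) := f (y + t *: v) - dot (grad f y) v * t.
have dphi (t : R) : is_derive t (1 : R) phi (dot (grad f (y + t *: v)) v - dot (grad f y) v).
  have := is_derive_line (df (y + t *: v)) => dl.
  by apply: is_derive_eq; rewrite /GRing.scale /= mulr1.
have hd (t : R) : 0 <= t <= 1 ->
    `|dot (grad f (y + t *: v)) v - dot (grad f y) v| <= L * enorm v ^+ 2 * t.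
  move=> /andP[t0 _]; rewrite -dotBl; apply: le_trans (CauchySchwarz _ _) _.
  apply: le_trans (ler_wpM2r (enorm_ge0 _) (lip _ _)) _.
  rewrite [y + _]addrC addrK enormZ ger0_norm//; lra.
have E : f (y + v) - f y - dot (grad f y) v = phi 1 - phi 0.
  rewrite /phi scale1r scale0r addr0; ring.
rewrite E ler_norml; apply/andP; split.
  have := @increment_le (- phi) (fun t => - (dot (grad f (y + t *: v)) v
     - dot (grad f y) v)) 0 (L * enorm v ^+ 2) _ _.
  rewrite add0r /= => H; have -> : phi 1 - phi 0 = - (- phi 1 - - phi 0) by ring.
  rewrite lerN2 mulrAC; apply: H => t t01.
  rewrite add0r; apply: le_trans (hd t t01); rewrite -normrN; exact: ler_norm.
have := @increment_le phi _ 0 (L * enorm v ^+ 2) (fun t _ => dphi t) _.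
rewrite add0r mulrAC; apply => t t01.
rewrite add0r; apply: le_trans (hd t t01); exact: ler_norm.
Qed.

End CalculusAlongLines.

(** * Second-order model at a critical point with Lipschitz Hessian *)

Section LocalModel.
Context {R : realType} {n : nat}.

(** Turns estimates at scale e -> 0 into statements on the quadratic form
    itself. *)
Lemma le_of_small_slack (a b c e0 : R) : 0 < e0 ->
  (forall e : R, 0 < e -> e < e0 -> a <= b + e * c) -> a <= b.
Proof.
move=> e00 H; apply/ler_addgt0Pr => d d0.
pose e := Num.min (e0 / 2) (d / (`|c| + 1)).
have c1 : 0 < `|c| + 1 by rewrite ltr_wpDl.
have e_gt0 : 0 < e by rewrite lt_min !divr_gt0.
have ee0 : e < e0.
  by apply: (@le_lt_trans _ _ (e0 / 2)); [rewrite ge_min lexx|lra].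
have ed : e * (`|c| + 1) <= d by rewrite -ler_pdivlMr// ge_min lexx orbT.
apply: le_trans (H e e_gt0 ee0) _; rewrite lerD2l.
apply: le_trans ed; rewrite ler_wpM2l ?(ltW e_gt0)//.
by apply: le_trans (ler_norm c) _; rewrite lerDl.
Qed.

Variables (f : 'cV[R]_n -> R) (L mu r K : R) (xs : 'cV[R]_n).
Hypothesis df : forall z, differentiable f z.
Hypothesis lipg : lipschitz_gradient f L.
Hypothesis g0 : grad f xs = 0.
Hypothesis r0 : 0 < r.
Hypothesis K0 : 0 <= K.
Hypothesis scf : strongly_convex_on (eball xs r) f mu.
Hypothesis dg : forall z, eball xs r z -> differentiable (grad f) z.
Hypothesis lipH : forall y z, eball xs r y -> eball xs r z ->
  opnorm (hessian f y - hessian f z) <= K * enorm (y - z).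

Let A := hessian f xs.

Lemma enorm_scale_small (v : 'cV[R]_n) : exists2 e0 : R, 0 < e0 &
  forall e : R, 0 < e -> e < e0 -> enorm (e *: v) < r.
Proof.
have v1 : 0 < enorm v + 1 by rewrite ltr_wpDl ?enorm_ge0.
exists (r / (enorm v + 1)) => [|e e0]; first exact: divr_gt0.
rewrite ltr_pdivlMr// => h; rewrite enormZ gtr0_norm//.
by apply: le_lt_trans h; rewrite ler_pM2l// lerDl.
Qed.

(** Strong convexity between xs and xs + t v, divided by t: since grad f xs = 0
    the difference f (xs + t v) - f xs is O(t^2), so the growth survives as t ->
    0. *)
Lemma strong_convexity_growth v : enorm v < r ->
  f xs + mu / 2 * enorm v ^+ 2 <= f (xs + v).
Proof.
move=> vr; apply: (@le_of_small_slack _ _ ((L / 2 + mu / 2) * enorm v ^+ 2) 1 ltr01).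
move=> t t0 t1.
have xsB : eball xs r xs by rewrite /eball /= subrr enorm0.
have vB : eball xs r (xs + v) by rewrite /eball /= addrC addKr.
have t01 : 0 <= t <= 1 by rewrite !ltW.
have := scf xsB vB t01.
have -> : (1 - t) *: xs + t *: (xs + v) = xs + t *: v.
  by rewrite scalerDr addrA -scalerDl subrK scale1r.
rewrite opprD addrA subrr add0r enormN => h1.
have := gradient_quadratic_bound xs (t *: v) df lipg.
rewrite g0 dot0l subr0 enormZ (gtr0_norm t0) ler_norml => /andP[h2 _].
rewrite -(ler_pM2l t0); move: h1 h2; set q := enorm v; set F := f _; set G := f _.
nra.
Qed.

(** The increment of grad f is tested against its own defect w, which reduces
    the vector-valued mean value estimate to a scalar one. *)
Lemma gradient_linearization u v : enorm u + enorm v < r ->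
  enorm (grad f (xs + u + v) - grad f (xs + u) - A *m v)
    <= K * (enorm u + enorm v) * enorm v.
Proof.
move=> uvr; set w := _ - _ - _.
have inB (t : R) : 0 <= t <= 1 -> enorm (u + t *: v) <= enorm u + enorm v.
  move=> /andP[t0 t1]; apply: le_trans (enormD _ _) _.
  by rewrite enormZ ger0_norm// lerD2l ler_piMl ?enorm_ge0.
have inBr (t : R) : 0 <= t <= 1 -> eball xs r (xs + u + t *: v).
  move=> t01; rewrite /eball /= -(addrA xs) addrAC subrr add0r.
  by apply: le_lt_trans (inB _ t01) uvr.
have xsB : eball xs r xs by rewrite /eball /= subrr enorm0.
have : dot w (grad f (xs + u + (1:R) *: v)) - dot w (grad f (xs + u + (0 : R) *: v))
   <= dot w (A *m v) + enorm w * (K * (enorm u + enorm v) * enorm v) + 0 / 2.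
  apply: (@increment_le _ (fun t : R => dot w (grad f (xs + u + t *: v)))
    (fun t : R => dot w (hessian f (xs + u + t *: v) *m v))) => t t01.
    by apply: is_derive_grad_line; apply: dg; exact: inBr.
  rewrite mul0r addr0 -lerBlDl -dotBr -mulmxBl.
  apply: le_trans (dot_le _ _) _; rewrite ler_wpM2l ?enorm_ge0//.
  apply: le_trans (opnorm_bound _ _) _; rewrite ler_wpM2r ?enorm_ge0//.
  apply: le_trans (lipH (inBr _ t01) xsB) _; rewrite ler_wpM2l//.
  by rewrite -(addrA xs) addrAC subrr add0r inB.
rewrite scale1r scale0r addr0 mul0r addr0 -lerBlDl -!dotBr -/w -enorm_sq expr2.
have [->|w0] := eqVneq (enorm w) 0.
  by rewrite !mulr_ge0 ?addr_ge0 ?enorm_ge0.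
by rewrite ler_pM2l// lt0r w0 enorm_ge0.
Qed.

(** Expansion around the displaced point xs + u rather than xs: comparing the
    two orders of adding u and v then yields the symmetry of the Hessian. *)
Lemma increment_quadratic_model u v : enorm u + enorm v < r ->
  `|f (xs + u + v) - f (xs + u) - (dot (A *m u) v + 2^-1 * dot (A *m v) v)|
    <= K * (enorm u + enorm v) ^+ 2 * enorm v.
Proof.
move=> uvr; set e := K * _ * _.
pose dphi (t : R) := dot (grad f (xs + u + t *: v)) v.
have dphiE (t : R) : is_derive t (1 : R) (fun s : R => f (xs + u + s *: v)) (dphi t).
  exact: is_derive_line.
have hd (t : R) : 0 <= t <= 1 ->
    `|dphi t - (dot (A *m u) v + dot (A *m v) v * t)| <= e.
  move=> /andP[t0 t1].
  have uv : enorm (u + t *: v) <= enorm u + enorm v.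
    apply: le_trans (enormD _ _) _.
    by rewrite enormZ ger0_norm// lerD2l ler_piMl ?enorm_ge0.
  have -> : dphi t - (dot (A *m u) v + dot (A *m v) v * t)
      = dot (grad f (xs + 0 + (u + t *: v)) - grad f (xs + 0) - A *m (u + t *: v)) v.
    rewrite /dphi addr0 g0 subr0 addrA mulmxDr -scalemxAr !dot_expand; ring.
  apply: le_trans (CauchySchwarz _ _) _; rewrite /e ler_wpM2r ?enorm_ge0//.
  apply: le_trans (gradient_linearization _) _.
    by rewrite enorm0 add0r (le_lt_trans uv).
  rewrite enorm0 add0r -mulrA ler_wpM2l// -expr2.
  by rewrite ler_pXn2r// ?nnegrE ?addr_ge0 ?enorm_ge0.
have up : f (xs + u + (1 : R) *: v) - f (xs + u + (0 : R) *: v)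
    <= dot (A *m u) v + e + dot (A *m v) v / 2.
  apply: (@increment_le _ (fun s : R => f (xs + u + s *: v)) dphi) => t t01.
  by have := hd t t01; rewrite ler_norml => /andP[]; lra.
have lo : - f (xs + u + (1 : R) *: v) - - f (xs + u + (0 : R) *: v)
    <= - dot (A *m u) v + e + - dot (A *m v) v / 2.
  apply: (@increment_le _ (- (fun s : R => f (xs + u + s *: v))) (fun t => - dphi t)) => t t01.
  by have := hd t t01; rewrite ler_norml => /andP[]; lra.
move: up lo; rewrite !scale1r !scale0r addr0 => up lo.
by rewrite ler_norml; apply/andP; split; lra.
Qed.

(** Going from xs to xs + e u + e v through either intermediate point gives the
    same value of f; the two quadratic expansions differ by e^2 (A u . v - A v .
    u) up to O(e^3). *)
Lemma hessian_symmetric : A^T = A.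
Proof.
suff symA u v : dot (A *m u) v <= dot (A *m v) u.
  apply/matrixP => i j; rewrite mxE.
  pose e k : 'cV[R]_n := delta_mx k 0.
  have E k l : dot (A *m e k) (e l) = A l k.
    rewrite -colE /dot (bigD1 l)//= big1 ?mxE ?eqxx ?mulr1 ?addr0//.
    by move=> p /negPf pl; rewrite !mxE pl mulr0.
  by apply/eqP; rewrite eq_le -!E !symA.
pose s := enorm u + enorm v.
have s0 : 0 <= s by rewrite addr_ge0 ?enorm_ge0.
have s1 : 0 < s + 1 by rewrite ltr_wpDl.
apply: (@le_of_small_slack _ _ (4 * K * s ^+ 3) (r / (s + 1))) => [|e e0 er].
  exact: divr_gt0.
have ser : e * s < r.
  by move: er; rewrite ltr_pdivlMr//; apply: le_lt_trans; rewrite ler_pM2l// lerDl.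
have eE (w : 'cV[R]_n) : enorm (e *: w) = e * enorm w by rewrite enormZ gtr0_norm.
have h1 := @increment_quadratic_model (e *: u) (e *: v).
have h2 := @increment_quadratic_model 0 (e *: u).
have h3 := @increment_quadratic_model (e *: v) (e *: u).
have h4 := @increment_quadratic_model 0 (e *: v).
rewrite !eE ?enorm0 ?add0r -?mulrDr in h1 h2 h3 h4.
rewrite (addrC (enorm v)) in h3.
rewrite -/s in h1 h3.
have us : enorm u <= s by rewrite lerDl enorm_ge0.
have vs : enorm v <= s by rewrite lerDr enorm_ge0.
have {}h1 := h1 ser; have {}h3 := h3 ser.
have {}h2 := h2 (le_lt_trans (ler_wpM2l (ltW e0) us) ser).
have {}h4 := h4 (le_lt_trans (ler_wpM2l (ltW e0) vs) ser).
rewrite (addrAC xs) in h3.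
rewrite !mulmx0 !dot0l !addr0 -?scalemxAr !dot_expand in h1 h2 h3 h4.
have B (x y : R) : 0 <= x -> x <= s -> 0 <= y -> y <= s ->
    K * (e * x) ^+ 2 * (e * y) <= e ^+ 3 * (K * s ^+ 3).
  move=> x0 xs' y0 ys.
  have -> : K * (e * x) ^+ 2 * (e * y) = e ^+ 3 * (K * (x ^+ 2 * y)) by ring.
  rewrite ler_wpM2l ?exprn_ge0 ?(ltW e0)// ler_wpM2l// (exprSr s 2).
  by rewrite ler_pM ?sqr_ge0// ler_pXn2r// ?nnegrE.
have b1 := le_trans h1 (B _ _ s0 (lexx s) (enorm_ge0 v) vs).
have b2 := le_trans h2 (B _ _ (enorm_ge0 u) us (enorm_ge0 u) us).
have b3 := le_trans h3 (B _ _ s0 (lexx s) (enorm_ge0 u) us).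
have b4 := le_trans h4 (B _ _ (enorm_ge0 v) vs (enorm_ge0 v) vs).
move: b1 b2 b3 b4; rewrite !ler_norml => /andP[b1 b1'] /andP[b2 b2'] /andP[b3 b3'] /andP[b4 b4'].
rewrite -(ler_pM2l (exprn_gt0 2 e0)).
have -> : e ^+ 2 * (dot (A *m v) u + e * (4 * K * s ^+ 3))
  = e ^+ 2 * dot (A *m v) u + 4 * (e ^+ 3 * (K * s ^+ 3)) by ring.
move: b1 b1' b2 b2' b3 b3' b4 b4'; set T := e ^+ 3 * _; rewrite !expr2; lra.
Qed.

Lemma hessian_upper v : enorm (A *m v) <= L * enorm v.
Proof.
have [e0 e00 he] := enorm_scale_small v.
apply: (@le_of_small_slack _ _ (K * enorm v ^+ 2) e0 e00) => e e_gt0 ee0.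
have := @gradient_linearization 0 (e *: v); rewrite enorm0 add0r => H.
have {}H := H (he e e_gt0 ee0); rewrite addr0 g0 subr0 in H.
have lg := lipg (xs + e *: v) xs; rewrite g0 subr0 (addrC xs) addrK addrC in lg.
have : enorm (A *m (e *: v)) <= L * enorm (e *: v) + K * enorm (e *: v) * enorm (e *: v).
  have -> : A *m (e *: v) = grad f (xs + e *: v) - (grad f (xs + e *: v) - A *m (e *: v)).
    by rewrite opprB addrC subrK.
  by apply: le_trans (enormB _ _) _; apply: lerD.
rewrite -scalemxAr !enormZ gtr0_norm// => h.
rewrite -(ler_pM2l e_gt0); move: h; nra.
Qed.

Lemma quadratic_model v : enorm v < r ->
  `|f (xs + v) - f xs - 2^-1 * dot v (A *m v)| <= K * enorm v ^+ 3.
Proof.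
move=> vr; have := @increment_quadratic_model 0 v.
rewrite enorm0 add0r addr0 mulmx0 dot0l add0r (dotC (A *m v)) => H.
by apply: le_trans (H vr) _; rewrite -mulrA -exprSr.
Qed.

Lemma hessian_lower v : mu * enorm v ^+ 2 <= dot v (A *m v).
Proof.
have [e0 e00 he] := enorm_scale_small v.
apply: (@le_of_small_slack _ _ (2 * K * enorm v ^+ 3) e0 e00) => e e_gt0 ee0.
have ev := he e e_gt0 ee0.
have := quadratic_model ev; rewrite ler_norml => /andP[_].
have := strong_convexity_growth ev.
rewrite enormZ gtr0_norm// -scalemxAr !dot_expand.
set q := enorm v; set p := dot _ _; set F := f _; set G := f _ => h1 h2.
rewrite -(ler_pM2l (exprn_gt0 2 e_gt0)); move: h1 h2; rewrite !exprMn !expr2 !exprS expr0; lra.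
Qed.

End LocalModel.

(** * Summability of the squared gradients *)

Section GlobalConvergence.
Context {R : realType} {n : nat}.

Lemma gradient_step_descent (f : 'cV[R]_n -> R) (L : R) y :
  (forall z, differentiable f z) -> 0 < L -> lipschitz_gradient f L ->
  f (gstep f L y) <= f y - (2 * L)^-1 * enorm (grad f y) ^+ 2.
Proof.
move=> df L0 lip.
have := gradient_quadratic_bound y (- (L^-1 *: grad f y)) df lip.
rewrite ler_norml => /andP[_].
rewrite enormN enormZ gtr0_norm ?invr_gt0// dotNr dotZr -enorm_sq -/(gstep f L y).
set F := f _; set G := f _; set q := enorm _.
have -> : L / 2 * (L^-1 * q) ^+ 2 = (2 * L)^-1 * q ^+ 2 by field; rewrite gt_eqF.
have -> : L^-1 * q ^+ 2 = 2 * ((2 * L)^-1 * q ^+ 2) by field; rewrite gt_eqF.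
lra.
Qed.

Variables (f : 'cV[R]_n -> R) (L : R) (m : nat) (gamma nu c1 c2 c3 : R).
Variables (x : nat -> 'cV[R]_n) (alpha : forall k, 'cV[R]_(mhat m k)).
Hypothesis df : forall z, differentiable f z.
Hypothesis L0 : 0 < L.
Hypothesis lipg : lipschitz_gradient f L.
Hypothesis gamma0 : 0 < gamma.
Hypothesis c20 : 0 < c2.
Hypothesis c2m : c2 < 1 / (2 * m%:R * L).
Hypothesis m0 : (1 <= m)%N.
Hypothesis AA : globalized_AA f L x alpha gamma nu c1 c2 c3.

(** Objective value plus the allowances c2 d^2 that the remaining steps of the
    current block may still consume. *)
Definition potential k : R := f (x k) +
  (if mhat m k == 0%N then 0
   else (m.+1 - mhat m k)%:R * (c2 * enorm (grad f (x (k - mhat m k)%N)) ^+ 2)).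

Let c := Num.min gamma ((2 * L)^-1 - m%:R * c2).

Lemma decrease_rate_gt0 : 0 < c.
Proof.
have mL : 0 < 2 * m%:R * L by rewrite !mulr_gt0// ltr0n.
rewrite lt_min gamma0 subr_gt0 -[ltRHS]mul1r ltr_pdivlMr ?mulr_gt0//.
move: c2m; rewrite ltr_pdivlMr// mulrC => /le_lt_trans; apply.
by rewrite le_eqVlt; apply/orP; left; apply/eqP; ring.
Qed.

(** At a block start the gradient step gains 1/(2L) times |grad f|^2, out of
    which m allowances c2 |grad f|^2 are set aside; every later step of the
    block either releases one of them or does not need it. *)
Lemma potential_decrease k :
  potential k.+1 <= potential k - c * enorm (grad f (x k)) ^+ 2.
Proof.
have mc2 : 0 <= m%:R * c2 by rewrite mulr_ge0// ltW.
have cg : c <= gamma by rewrite ge_min lexx.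
have cL : c <= (2 * L)^-1 - m%:R * c2 by rewrite ge_min lexx orbT.
have jm : (mhat m k <= m)%N by rewrite -ltnS ltn_pmod.
have descent := gradient_step_descent (x k) df L0 lipg.
have q0 := sqr_ge0 (enorm (grad f (x k))).
have [stepG stepA] := AA k.
rewrite /potential; set d2 := c2 * enorm (grad f (x (k - mhat m k)%N)) ^+ 2.
have d20 : 0 <= d2 by rewrite mulr_ge0 ?sqr_ge0// ltW.
have E : (if mhat m k.+1 == 0%N then 0
   else (m.+1 - mhat m k.+1)%:R * (c2 * enorm (grad f (x (k.+1 - mhat m k.+1)%N)) ^+ 2))
   <= (m - mhat m k)%:R * d2.
  have -> : mhat m k.+1 = if (m.+1 %| k.+1)%N then 0%N else (mhat m k).+1.
    exact: modnS.
  by case: (_ %| _)%N; [rewrite eqxx mulr_ge0|rewrite !subSS].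
apply: le_trans (lerD (lexx _) E) _; rewrite subSn//.
case: eqP => [k0|/stepA[_ ->]].
  rewrite stepG// k0 subn0 addr0 /d2 k0 subn0.
  set q := enorm _ ^+ 2 in descent q0 *.
  have := ler_wpM2r q0 cL; move: descent; set F := f _; set G := f _ => h1; lra.
rewrite -natr1 mulrDl mul1r.
case: ifP => [|_].
  rewrite /AA_accept; move=> h.
  have : f (xAA f L x alpha k) <= f (x k) - gamma * enorm (grad f (x k)) ^+ 2 + d2.
    apply: le_trans h _; rewrite lerD2l.
    by rewrite ge_min; apply/orP; right; rewrite ge_min lexx.
  have := ler_wpM2r q0 cg; lra.
have := ler_wpM2r q0 cL; rewrite mulrBl.
have := mulr_ge0 mc2 q0; move: descent; lra.
Qed.

(** At multiples of m+1 no allowance is outstanding, so the potential equals f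
    there. *)
Lemma block_start_decrease l :
  f (x (l.+1 * m.+1)%N) <= f (x (l * m.+1)%N).
Proof.
have P0 i : potential (i * m.+1)%N = f (x (i * m.+1)%N).
  by rewrite /potential /mhat modnMl eqxx addr0.
have dec k i : potential (k + i)%N <= potential k.
  elim: i => [|i IH]; first by rewrite addn0.
  rewrite addnS; apply: le_trans IH; apply: le_trans (potential_decrease _) _.
  by rewrite gerBl mulr_ge0 ?sqr_ge0// ltW ?decrease_rate_gt0.
by rewrite -!P0 mulSn addnC dec.
Qed.

Hypothesis lbf : has_lbound (range f).

Lemma gradient_sq_sum_bound : exists C, forall N,
  \sum_(0 <= k < N) enorm (grad f (x k)) ^+ 2 <= C.
Proof.
have [lb lbP] := lbf.
have lbpot k : lb <= potential k.
  apply: (@le_trans _ _ (f (x k))); first by apply: lbP; exists (x k).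
  rewrite lerDl; case: ifP => // _.
  by apply: mulr_ge0 => //; apply: mulr_ge0; [exact: ltW|exact: sqr_ge0].
have tele N : c * (\sum_(0 <= k < N) enorm (grad f (x k)) ^+ 2)
    <= potential 0 - potential N.
  elim: N => [|N IH]; first by rewrite big_geq// mulr0 subrr.
  rewrite (big_nat_recr _ _ _ (leq0n N)) mulrDr.
  apply: le_trans (lerD IH (lexx _)) _; rewrite -addrA lerD2l lerNr opprD opprK.
  exact: potential_decrease.
exists ((potential 0 - lb) / c) => N; rewrite ler_pdivlMr ?decrease_rate_gt0// mulrC.
by apply: le_trans (tele N) _; rewrite lerD2l lerN2.
Qed.

Lemma gradient_summable :
  (\sum_(0 <= k <oo) (enorm (grad f (x k)) ^+ 2)%:E < +oo)%E.
Proof.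
have [C hC] := gradient_sq_sum_bound.
apply: (@le_lt_trans _ _ C%:E); last exact: ltry.
apply: lime_le.
  by apply: is_cvg_nneseries => k _ _; rewrite lee_fin sqr_ge0.
by apply: nearW => N; rewrite sumEFin lee_fin.
Qed.

Lemma gradient_to_0 : (fun k => enorm (grad f (x k))) @ \oo --> (0 : R).
Proof.
have [C hC] := gradient_sq_sum_bound.
have cs : cvgn (series (fun k => enorm (grad f (x k)) ^+ 2)).
  apply: nondecreasing_is_cvgn.
    by apply: nondecreasing_series => k _ _; exact: sqr_ge0.
  by exists C => _ [N _ <-]; exact: hC.
have := cvg_series_cvg_0 cs => h.
have -> : (fun k => enorm (grad f (x k))) =
   (fun k => Num.sqrt (enorm (grad f (x k)) ^+ 2)).
  by apply/funext => k; rewrite sqrtr_sqr ger0_norm ?enorm_ge0.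
have := cvg_comp _ _ h (@sqrt_continuous R 0); rewrite sqrtr0; exact.
Qed.

End GlobalConvergence.

(** * One minimal-residual step for a perturbed quadratic *)

Section QuadraticSteps.
Context {R : realType} {n : nat}.

(** From (a - b)(s - lam) >= - e one wants b (s - lam) >= - O(e), which requires
    b to be dominated by a - b.  The contraction b <= (1 - c) a + e provides
    this unless a = O(e), and then the crude bound through kappa a suffices. *)
Lemma scalar_progress (a b s lam c kappa e : R) :
  0 < c -> 0 <= kappa -> 0 <= e -> 0 <= b -> b <= a ->
  - e <= (a - b) * (s - lam) ->
  b <= (1 - c) * a + e ->
  - kappa * a - e <= b * (s - lam) ->
  - (2 / c * (1 + kappa) + 1) * e <= b * (s - lam).
Proof.
move=> c0 k0 e0 b0 ba h1 h2 h3.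
have ic0 : 0 < c^-1 by rewrite invr_gt0.
have cic : c * c^-1 = 1 by rewrite divff// gt_eqF.
have [ls|sl] := leP lam s.
  apply: (@le_trans _ _ 0); last by rewrite mulr_ge0// subr_ge0.
  by rewrite mulNr oppr_le0 !mulr_ge0// addr_ge0// ?mulr_ge0// ?addr_ge0// ltW.
have cke : 0 <= c^-1 * (kappa * e) by rewrite !mulr_ge0// ltW.
have ce : 0 <= c^-1 * e by rewrite mulr_ge0// ltW.
(* Either a is itself of the order of the error, or a - b dominates b. *)
have [cae|eca] := leP (c * a) (2 * e).
  have a_le : a <= 2 * (c^-1 * e).
    have := ler_wpM2l (ltW ic0) cae.
    by rewrite (mulrA c^-1 c) (mulrC c^-1 c) cic mul1r (mulrCA c^-1).
  have := ler_wpM2l k0 a_le; move: h3 cke ce e0.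
  by rewrite mulrCA (mulrCA kappa); lra.
have ab : c * b <= 2 * (a - b).
  have := ler_wpM2l (ltW c0) ba; move: h2 eca; lra.
have := ler_wpM2r (ltW (_ : 0 < lam - s)) ab; rewrite subr_gt0 => /(_ sl) h4.
have h5 : c * (b * (lam - s)) <= 2 * e by move: h4 h1; lra.
have := ler_wpM2l (ltW ic0) h5.
rewrite (mulrA c^-1 c) (mulrC c^-1 c) cic mul1r (mulrCA c^-1).
move: cke ce e0; lra.
Qed.

Variables (A : 'M[R]_n) (L mu : R).
Hypothesis L0 : 0 < L.
Hypothesis mu0 : 0 < mu.
Hypothesis symA : A^T = A.
Hypothesis upA : forall v, enorm (A *m v) <= L * enorm v.
Hypothesis loA : forall v, mu * enorm v ^+ 2 <= dot v (A *m v).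

Lemma dot_mulmx_sym u v : dot u (A *m v) = dot (A *m u) v.
Proof. by rewrite dot_trmx symA. Qed.

Lemma hessian_cocoercive v : enorm (A *m v) ^+ 2 <= L * dot v (A *m v).
Proof.
apply: psd_cocoercive => // u; apply: le_trans (loA u).
by rewrite mulr_ge0 ?sqr_ge0// ltW.
Qed.

Lemma hessian_injective v : mu * enorm v <= enorm (A *m v).
Proof.
have [->|v0] := eqVneq v 0; first by rewrite mulmx0 !enorm0 mulr0.
have ev : 0 < enorm v by rewrite lt0r enorm_eq0 v0 enorm_ge0.
rewrite -(ler_pM2l ev); apply: le_trans (dot_le _ _).
by apply: le_trans (loA v); rewrite mulrCA expr2.
Qed.

Lemma enorm_sq_perturb (u d : 'cV[R]_n) (B eta zeta : R) :
  enorm u <= B * zeta -> enorm d <= 2 * eta -> eta <= zeta -> 0 <= B ->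
  enorm (u + d) ^+ 2 <= enorm u ^+ 2 + (4 * B + 4) * (eta * zeta).
Proof.
move=> hu hd ez B0.
have u0 := enorm_ge0 u; have d0 := enorm_ge0 d.
have eta0 : 0 <= eta by lra.
have : enorm (u + d) ^+ 2 <= (enorm u + enorm d) ^+ 2.
  by rewrite ler_pXn2r// ?nnegrE ?addr_ge0 ?enorm_ge0// enormD.
have h1 : enorm u * enorm d <= B * zeta * (2 * eta) by exact: ler_pM.
have h2 : enorm d * enorm d <= 2 * eta * (2 * eta) by exact: ler_pM.
have h3 : eta * eta <= eta * zeta by exact: ler_wpM2l.
rewrite !expr2; move: h1 h2 h3; nra.
Qed.

(** Here z' and z are consecutive averaged points relative to the solution, rho'
    and rho their residuals, g the gradient at the point z' - rho' / L reached
    from z'; eta bounds the defects from the linear model and zeta the sizes.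
    The three inputs of [scalar_progress] are, for a = |rho'|^2, b = |rho|^2 and
    t = z' - z: cocoercivity on t, because |rho' - rho|^2 = a - b; contraction
    of the step I - A / L together with |rho| <= |g|; and |t| = O(|rho' - rho|)
    by strong convexity. *)
Lemma minres_progress : exists2 C, 0 <= C &
  forall (rho rho' z z' g : 'cV[R]_n) (sigma eta zeta : R),
  dot rho (z' - z) = sigma * enorm rho ^+ 2 ->
  dot rho' (z' - z) = sigma * enorm rho' ^+ 2 ->
  dot rho rho' = enorm rho ^+ 2 ->
  enorm rho <= enorm g ->
  enorm (rho - A *m z) <= eta -> enorm (rho' - A *m z') <= eta ->
  enorm (g - A *m (z' - L^-1 *: rho')) <= eta ->
  enorm rho <= zeta -> enorm rho' <= zeta -> enorm z <= zeta -> enorm z' <= zeta ->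
  eta <= zeta ->
  - C * (eta * zeta) <= dot rho (z' - z) - L^-1 * enorm rho ^+ 2.
Proof.
have iL0 : 0 < L^-1 by rewrite invr_gt0.
have imu0 : 0 < mu^-1 by rewrite invr_gt0.
(* Squared norms contract by the factor 1 - c under I - A / L. *)
pose c := mu / L; have c0 : 0 < c by rewrite divr_gt0.
pose kappa := mu^-1 + L^-1; have kappa0 : 0 <= kappa by rewrite addr_ge0// ltW.
pose q := 20 + 4 / L + 2 / mu.
have q0 : 0 <= q by rewrite !addr_ge0// mulr_ge0// ltW.
exists ((2 / c * (1 + kappa) + 1) * q).
  apply: mulr_ge0 => //; apply: addr_ge0 => //; apply: mulr_ge0.
    by rewrite divr_ge0// ltW.
  exact: addr_ge0.
move=> rho rho' z z' g sigma eta zeta hs hs' hr hg d1 d2 d3 z1 z2 z3 z4 ez.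
have eta0 : 0 <= eta by apply: le_trans d1; exact: enorm_ge0.
have zeta0 : 0 <= zeta by apply: le_trans z1; exact: enorm_ge0.
set t := z' - z in hs hs' *.
set a := enorm rho' ^+ 2; set b := enorm rho ^+ 2.
pose w := eta * zeta; have w0 : 0 <= w by rewrite mulr_ge0.
pose d := (rho' - A *m z') - (rho - A *m z).
have dE : rho' - rho = A *m t + d.
  rewrite /t /d mulmxBr; apply/matrixP => i j; rewrite !mxE; ring.
have hd : enorm d <= 2 * eta by apply: le_trans (enormB _ _) _; lra.
have ht : enorm t <= 2 * zeta by apply: le_trans (enormB _ _) _; lra.
have hAt : enorm (A *m t) <= 2 * L * zeta.
  by apply: le_trans (upA t) _; have := ler_wpM2l (ltW L0) ht; lra.
have dab : enorm (rho' - rho) ^+ 2 = a - b.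
  rewrite enorm_sq !dot_expand (dotC rho' rho) hr -!enorm_sq /a /b; ring.
have ba : b <= a by rewrite -subr_ge0 -dab sqr_ge0.
have b0 : 0 <= b by exact: sqr_ge0.
have b_sig : dot rho t - L^-1 * b = b * (sigma - L^-1) by rewrite hs /b; ring.
rewrite b_sig.
(* The shared ratio sigma turns the inner product with the difference of the
   residuals into a multiple of a - b. *)
have ab_sig : (a - b) * sigma = dot (A *m t) t + dot d t.
  by rewrite -dotDl -dE dotBl hs hs' /a /b; ring.
have hdt : - (4 * w) <= dot d t.
  have := CauchySchwarz d t; rewrite ler_norml => /andP[h _]; apply: le_trans h.
  rewrite lerN2; have := ler_pM (enorm_ge0 d) (enorm_ge0 t) hd ht.
  rewrite /w; lra.
have iLL : L^-1 * L = 1 by rewrite mulVf// gt_eqF.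
have h1 : (a - b) * L^-1 <= dot (A *m t) t + (8 + 4 / L) * w.
  have := @enorm_sq_perturb (A *m t) d (2 * L) eta zeta hAt hd ez.
  rewrite -dE dab => H; have {}H := H (ltW (mulr_gt0 (ltr0Sn _ 1) L0)).
  have := hessian_cocoercive t; rewrite dotC => H2.
  rewrite mulrC; have := ler_wpM2l (ltW iL0) (le_trans H (lerD H2 (lexx _))).
  rewrite (mulrDr L^-1 (L * _)) (mulrA L^-1 L) iLL mul1r -/w => H3; apply: le_trans H3 _.
  rewrite lerD2l.
  have -> : L^-1 * ((4 * (2 * L) + 4) * w) = (8 * (L^-1 * L) + 4 / L) * w by ring.
  by rewrite iLL mulr1.
have h2 : b <= (1 - c) * a + 8 * w.
  (* Up to eta, g is the residual rho' after one plain gradient step. *)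
  pose u := rho' - L^-1 *: (A *m rho').
  have uu : enorm u ^+ 2 <= (1 - c) * a.
    rewrite /u enorm_sq !dot_expand -!enorm_sq (dotC (A *m rho')) -/a.
    have H := hessian_cocoercive rho'; have H2 := loA rho'.
    have H3 := ler_wpM2l (ltW iL0) H; rewrite (mulrA L^-1 L) iLL mul1r in H3.
    have H4 := ler_wpM2l (ltW iL0) H3; have H5 := ler_wpM2l (ltW iL0) H2.
    rewrite -/a in H5; rewrite /c; move: H4 H5; lra.
  have ut : enorm u <= 1 * zeta.
    rewrite mul1r; apply: le_trans z2.
    rewrite -(@ler_pXn2r _ 2)// ?nnegrE ?enorm_ge0//.
    by apply: le_trans uu _; rewrite ler_piMl ?sqr_ge0// lerBlDr lerDl ltW.
  pose d' := (g - A *m (z' - L^-1 *: rho')) - (rho' - A *m z').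
  have hd' : enorm d' <= 2 * eta by apply: le_trans (enormB _ _) _; lra.
  have gE : g = u + d'.
    rewrite /u /d' mulmxBr -scalemxAr; apply/matrixP => i j; rewrite !mxE; ring.
  have := @enorm_sq_perturb u d' 1 eta zeta ut hd' ez ler01; rewrite -gE -/w.
  have : b <= enorm g ^+ 2 by rewrite ler_pXn2r// ?nnegrE ?enorm_ge0.
  by move: uu; lra.
have h3 : - kappa * a - 2 / mu * w <= b * (sigma - L^-1).
  rewrite -b_sig.
  have mt : mu * enorm t <= enorm (rho' - rho) + 2 * eta.
    apply: le_trans (hessian_injective t) _.
    have -> : A *m t = (rho' - rho) - d by rewrite dE addrK.
    by apply: le_trans (enormB _ _) _; rewrite lerD2l.
  have H : mu * (enorm rho * enorm t) <= a + 2 * w.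
    have H1 := ler_wpM2l (enorm_ge0 rho) mt.
    have H2 : enorm rho * (2 * eta) <= 2 * w.
      by have := ler_wpM2r eta0 z1; rewrite /w; lra.
    have H3 : enorm rho * enorm (rho' - rho) <= a.
      have : 2 * (enorm rho * enorm (rho' - rho)) <= b + (a - b).
        rewrite -dab -subr_ge0 /b.
        have := sqr_ge0 (enorm rho - enorm (rho' - rho)).
        by rewrite sqrrB; lra.
      have := mulr_ge0 (enorm_ge0 rho) (enorm_ge0 (rho' - rho)); lra.
    move: H1 H2 H3; lra.
  have {}H := ler_wpM2l (ltW imu0) H.
  rewrite (mulrA mu^-1 mu) mulVf ?gt_eqF// mul1r in H.
  have := CauchySchwarz rho t; rewrite ler_norml => /andP[H2 _].
  have H3 := ler_wpM2l (ltW iL0) ba.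
  move: H H2 H3; rewrite /kappa; lra.
have -> : - ((2 / c * (1 + kappa) + 1) * q) * (eta * zeta)
    = - (2 / c * (1 + kappa) + 1) * (q * w) by rewrite /w; ring.
apply: (@scalar_progress a) => //.
- exact: mulr_ge0.
- move: h1 hdt ab_sig; set P := dot (A *m t) t; set Q := dot d t => h1 hdt ab_sig.
  rewrite mulrBr ab_sig /q.
  have := mulr_ge0 (ltW imu0) w0; have := mulr_ge0 (ltW iL0) w0; lra.
- apply: le_trans h2 _; rewrite lerD2l ler_wpM2r// /q.
  by have : 0 <= 4 / L + 2 / mu; [rewrite addr_ge0// divr_ge0// ltW|lra].
- apply: le_trans h3; rewrite mulNr lerD2l lerN2 ler_wpM2r// /q.
  by have : 0 <= 4 / L; [rewrite divr_ge0// ltW|lra].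
Qed.

(** With s = v - z the quadratic model satisfies q (v) - q (z - rho / L) >= rho
    . s + (|A s|^2 + |rho|^2) / (2L) up to errors, and orthogonality gives |g|^2
    = |rho|^2 + |g - rho|^2 with g - rho close to A s. *)
Lemma accelerated_step_descent : exists2 C, 0 <= C &
  forall (rho z v g : 'cV[R]_n) (Fv Fz e1 e2 eta zeta : R),
  dot g rho = enorm rho ^+ 2 ->
  - e1 <= dot rho (v - z) ->
  enorm (rho - A *m z) <= eta -> enorm (g - A *m v) <= eta ->
  enorm rho <= zeta -> enorm z <= zeta -> enorm v <= zeta -> eta <= zeta ->
  `|Fv - 2^-1 * dot v (A *m v)| <= e2 ->
  `|Fz - 2^-1 * dot (z - L^-1 *: rho) (A *m (z - L^-1 *: rho))| <= e2 ->
  Fz <= Fv - (2 * L)^-1 * enorm g ^+ 2 + (e1 + 2 * e2 + C * (eta * zeta)).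
Proof.
have iL0 : 0 < L^-1 by rewrite invr_gt0.
have iLL : L^-1 * L = 1 by rewrite mulVf// gt_eqF.
exists (6 + 3 / L); first by rewrite addr_ge0// divr_ge0// ltW.
move=> rho z v g Fv Fz e1 e2 eta zeta gr rs d1 d2 z1 z2 z3 ez hv hz.
have eta0 : 0 <= eta by apply: le_trans d1; exact: enorm_ge0.
have zeta0 : 0 <= zeta by apply: le_trans z1; exact: enorm_ge0.
pose w := eta * zeta; have w0 : 0 <= w by rewrite mulr_ge0.
pose s := v - z; have vE : v = z + s by rewrite /s addrC subrK.
pose d := rho - A *m z; have AzE : A *m z = rho - d by rewrite /d opprB addrC subrK.
have hs : enorm s <= 2 * zeta by apply: le_trans (enormB _ _) _; lra.
rewrite -/s in rs; clearbody s.
pose dd := (g - A *m v) - d.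
have hdd : enorm dd <= 2 * eta by apply: le_trans (enormB _ _) _; rewrite /d; lra.
have gE : g - rho = A *m s + dd.
  rewrite /dd /d {1}vE mulmxDr; move: (A *m z) (A *m s) => p q.
  by apply/matrixP => i j; rewrite !mxE; ring.
have hAs : enorm (A *m s) <= 2 * L * zeta.
  by apply: le_trans (upA s) _; have := ler_wpM2l (ltW L0) hs; lra.
have grE : enorm (g - rho) ^+ 2 = enorm g ^+ 2 - enorm rho ^+ 2.
  rewrite enorm_sq !dot_expand (dotC rho g) gr -!enorm_sq; ring.
have H1 := @enorm_sq_perturb (A *m s) dd (2 * L) eta zeta hAs hdd ez
  (ltW (mulr_gt0 (ltr0Sn _ 1) L0)).
rewrite -gE grE -/w in H1.
have H2 : (enorm g ^+ 2 - enorm rho ^+ 2) / L <= dot s (A *m s) + (8 + 4 / L) * w.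
  rewrite mulrC; have := ler_wpM2l (ltW iL0) (le_trans H1 (lerD (hessian_cocoercive s) (lexx _))).
  rewrite (mulrDr L^-1 (L * _)) (mulrA L^-1 L) iLL mul1r => H3; apply: le_trans H3 _.
  rewrite lerD2l.
  have -> : L^-1 * ((4 * (2 * L) + 4) * w) = (8 * (L^-1 * L) + 4 / L) * w by ring.
  by rewrite iLL mulr1.
have H3 : - (2 * w) <= - dot d s.
  rewrite lerN2; apply: le_trans (dot_le _ _) _.
  by have := ler_pM (enorm_ge0 d) (enorm_ge0 s) d1 hs; rewrite /w; lra.
have H4 : - dot rho (A *m z) <= - enorm rho ^+ 2 + w.
  rewrite AzE dotBr -enorm_sq opprB addrC lerD2l dotC.
  apply: le_trans (dot_le _ _) _; exact: ler_pM (enorm_ge0 _) (enorm_ge0 _) d1 z1.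
have H5 : dot rho (A *m rho) <= L * enorm rho ^+ 2.
  apply: le_trans (dot_le _ _) _; rewrite expr2 mulrCA.
  by rewrite ler_wpM2l ?enorm_ge0.
have qv : dot v (A *m v) = dot z (A *m z) + 2 * (dot rho s - dot d s) + dot s (A *m s).
  rewrite vE mulmxDr !dot_expand (dot_mulmx_sym z s) (dotC s (A *m z)) AzE !dot_expand; ring.
have qz : dot (z - L^-1 *: rho) (A *m (z - L^-1 *: rho))
    = dot z (A *m z) - 2 * (L^-1 * dot rho (A *m z)) + L^-1 * (L^-1 * dot rho (A *m rho)).
  rewrite mulmxBr -scalemxAr !dot_expand (dot_mulmx_sym z rho) (dotC (A *m z)); ring.
rewrite qv in hv; rewrite qz in hz.
have H4' := ler_wpM2l (ltW iL0) H4.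
have H5' := ler_wpM2l (ltW iL0) (ler_wpM2l (ltW iL0) H5).
rewrite (mulrA L^-1 L) iLL mul1r in H5'.
have -> : (2 * L)^-1 = 2^-1 * L^-1 by rewrite invfM.
rewrite -/w.
move: hv hz; rewrite !ler_norml => /andP[hv _] /andP[_ hz].
move: H2 H3 H4' H5' rs hv hz.
set P := dot z (A *m z); set Q := dot rho (A *m z); set S := dot rho (A *m rho).
set T := dot s (A *m s); set U := dot rho s; set W := dot d s.
set gg := enorm g ^+ 2; set rr := enorm rho ^+ 2.
clearbody P Q S T U W gg rr w; clear -w0; lra.
Qed.

End QuadraticSteps.

(** * A single restart block close to the critical point *)

Section RestartBlock.
Context {R : realType} {n : nat}.

(** Columns of the difference matrices are anchored at the first iterate u 0 of
    the block; coefficients are indexed by nat, so that the number j of columns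
    can vary inside a block without changing types. *)
Definition combo (u : nat -> 'cV[R]_n) (a : nat -> R) (j : nat) : 'cV[R]_n :=
  \sum_(i < j) a i *: (u i.+1 - u 0%N).

Lemma combo0 u j : combo u (fun=> 0) j = 0.
Proof. by rewrite /combo big1// => i _; rewrite scale0r. Qed.

Lemma combo_bump u a j i t : (i < j)%N ->
  combo u (fun l => a l + t * (l == i)%:R) j = combo u a j + t *: (u i.+1 - u 0%N).
Proof.
move=> ij; rewrite /combo; under eq_bigr do rewrite scalerDl.
rewrite big_split /=; congr (_ + _).
rewrite (bigD1 (Ordinal ij))//= eqxx mulr1 big1 ?addr0// => l.
by rewrite -val_eqE /= => /negPf ->; rewrite mulr0 scale0r.
Qed.

Lemma orthogonal_of_min (p y : 'cV[R]_n) :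
  (forall t : R, enorm p <= enorm (p + t *: y)) -> dot p y = 0.
Proof.
move=> H; have [->|y0] := eqVneq y 0; first by rewrite dot0r.
have yy : 0 < dot y y.
  by rewrite -enorm_sq exprn_gt0// lt0r enorm_eq0 y0 enorm_ge0.
(* The value of t minimizing the norm along the line. *)
have := H (- (dot p y / dot y y)).
rewrite -(@ler_pXn2r _ 2)// ?nnegrE ?enorm_ge0// !enorm_sq !dot_expand (dotC y p).
set s := dot p y; set q := dot y y in yy *; set P := dot p p => h.
have E : P + - (s / q) * s + (- (s / q) * s + - (s / q) * (- (s / q) * q))
    = P - s ^+ 2 / q by field; rewrite gt_eqF.
have : s ^+ 2 / q <= 0 by move: h E; set Z := s ^+ 2 / q; lra.
rewrite pmulr_lle0 ?invr_gt0// => h2.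
by apply/eqP; rewrite -sqrf_eq0 eq_le h2 sqr_ge0.
Qed.

Variables (f : 'cV[R]_n -> R) (L mu r K M : R) (m : nat) (xs : 'cV[R]_n) (A : 'M[R]_n).
Hypothesis L0 : 0 < L.
Hypothesis mu0 : 0 < mu.
Hypothesis r0 : 0 < r.
Hypothesis K0 : 0 <= K.
Hypothesis M0 : 0 <= M.
Hypothesis lipg : lipschitz_gradient f L.
Hypothesis g0 : grad f xs = 0.
Hypothesis symA : A^T = A.
Hypothesis upA : forall v, enorm (A *m v) <= L * enorm v.
Hypothesis loA : forall v, mu * enorm v ^+ 2 <= dot v (A *m v).
Hypothesis linA : forall u v, enorm u + enorm v < r ->
  enorm (grad f (xs + u + v) - grad f (xs + u) - A *m v)
    <= K * (enorm u + enorm v) * enorm v.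
Hypothesis quadA : forall v, enorm v < r ->
  `|f (xs + v) - f xs - 2^-1 * dot v (A *m v)| <= K * enorm v ^+ 3.

Section OneBlock.
Variables (w : nat -> 'cV[R]_n) (co : nat -> nat -> R).

Let g i := grad f (w i).

(** Relative to xs: this is y_j - xs, the variable in which the model is linear. *)
Definition averaged j : 'cV[R]_n := w 0%N - xs + combo w (co j) j.

Definition residual j : 'cV[R]_n := g 0%N + combo g (co j) j.

Definition accelerated j : 'cV[R]_n := xs + averaged j - L^-1 *: residual j.

(** What the local analysis uses of one block: least-squares optimality, the
    consequence of the condition number bound from [cond_number_gram], and the
    two possible updates. *)
Definition AA_block : Prop :=
  [/\ forall j a, (j <= m)%N -> enorm (residual j) <= enorm (g 0%N + combo g a j),
      forall j a i, (j <= m)%N -> (i < j)%N ->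
        enorm (w i.+1 - w 0%N) * `|a i| <= M * enorm (combo w a j) &
      forall j, (j <= m)%N ->
        w j.+1 = accelerated j \/ w j.+1 = gstep f L (w j)].

Lemma residual_orthogonal j i : AA_block -> (j <= m)%N -> (i < j)%N ->
  dot (residual j) (g i.+1 - g 0%N) = 0.
Proof.
move=> [ls _ _] jm ij; apply: orthogonal_of_min => t.
by rewrite -addrA -(combo_bump _ _ _ ij) ls.
Qed.

Lemma residual_dot_combo j i a : AA_block -> (j <= m)%N -> (i <= j)%N ->
  dot (residual j) (combo g a i) = 0.
Proof.
move=> B jm ij; rewrite dot_sumr big1// => l _.
by rewrite dotZr residual_orthogonal ?mulr0// (leq_trans (ltn_ord l)).
Qed.

Lemma residual_dot_start j : AA_block -> (j <= m)%N ->
  dot (residual j) (g 0%N) = enorm (residual j) ^+ 2.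
Proof.
by move=> B jm; rewrite enorm_sq {3}/residual dotDr residual_dot_combo// addr0.
Qed.

Lemma residual_dot_residual j i : AA_block -> (j <= m)%N -> (i <= j)%N ->
  dot (residual j) (residual i) = enorm (residual j) ^+ 2.
Proof.
move=> B jm ij.
by rewrite {2}/residual dotDr residual_dot_combo// addr0 residual_dot_start.
Qed.

Lemma residual_dot_gradient j i : AA_block -> (j <= m)%N -> (i <= j)%N ->
  dot (residual j) (g i) = enorm (residual j) ^+ 2.
Proof.
move=> B jm; case: i => [_|i ij]; first exact: residual_dot_start.
have -> : g i.+1 = g 0%N + (g i.+1 - g 0%N) by rewrite addrC subrK.
by rewrite dotDr residual_orthogonal// addr0 residual_dot_start.
Qed.

Lemma residual_le_gradient j i : AA_block -> (j <= m)%N -> (i <= j)%N ->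
  enorm (residual j) <= enorm (g i).
Proof.
move=> B jm ij; have [->|rn0] := eqVneq (enorm (residual j)) 0; first exact: enorm_ge0.
have r_gt0 : 0 < enorm (residual j) by rewrite lt0r rn0 enorm_ge0.
rewrite -(ler_pM2l r_gt0) -expr2 -(residual_dot_gradient B jm ij).
exact: dot_le.
Qed.

(** The functionals v |-> residual l . v, divided by |residual l|^2, take the
    same value on v for all l between lo and hi; multiplying out keeps this
    meaningful when a residual vanishes. *)
Definition common_ratio lo hi (v : 'cV[R]_n) := exists s : R,
  forall l, (lo <= l <= hi)%N -> dot (residual l) v = s * enorm (residual l) ^+ 2.

Lemma common_ratio_lin lo hi a u v :
  common_ratio lo hi u -> common_ratio lo hi v -> common_ratio lo hi (a *: u + v).
Proof.
move=> [s hs] [t ht]; exists (a * s + t) => l hl.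
by rewrite dotDr dotZr hs// ht//; ring.
Qed.

Lemma common_ratio0 lo hi : common_ratio lo hi 0.
Proof. by exists 0 => l _; rewrite dot0r mul0r. Qed.

Lemma common_ratio_combo lo hi a j :
  (forall i, (i < j)%N -> common_ratio lo hi (w i.+1 - w 0%N)) ->
  common_ratio lo hi (combo w a j).
Proof.
elim: j => [|j IH] H; first by rewrite /combo big_ord0; exact: common_ratio0.
rewrite /combo big_ord_recr [X in common_ratio _ _ X]addrC; apply: common_ratio_lin; first exact: H.
by apply: IH => i ij; apply: H; rewrite ltnS ltnW.
Qed.

(** An accepted iterate is w 0 plus a combination of earlier differences minus
    residual i / L, and residual l . residual i = |residual l|^2 for i <= l; so
    the property propagates from the earlier iterates with ratio changed by - 1
    / L. *)
Lemma common_ratio_iterates hi : AA_block -> (hi <= m)%N ->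
  (forall i, (i < hi)%N -> w i.+1 = accelerated i) ->
  forall i, (i < hi)%N -> common_ratio i hi (w i.+1 - w 0%N).
Proof.
move=> B hm acc; elim/ltn_ind => i IH ihi.
have -> : w i.+1 - w 0%N = - L^-1 *: residual i + combo w (co i) i.
  rewrite acc// /accelerated /averaged scaleNr.
  by move: (combo _ _ _) (L^-1 *: _) => c q; apply/matrixP => ? ?; rewrite !mxE; ring.
apply: common_ratio_lin.
  exists 1 => l /andP[il lh]; rewrite mul1r residual_dot_residual//.
  exact: leq_trans lh hm.
apply: common_ratio_combo => l li.
have [s hs] := IH l li (ltn_trans li ihi); exists s => p /andP[ip ph].
by apply: hs; rewrite ph (leq_trans (ltnW li) ip).
Qed.

Lemma averaged_common_ratio j : AA_block -> (j < m)%N ->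
  (forall i, (i <= j)%N -> w i.+1 = accelerated i) ->
  common_ratio j j.+1 (averaged j - averaged j.+1).
Proof.
move=> B jm acc.
have H i : (i < j.+1)%N -> common_ratio j j.+1 (w i.+1 - w 0%N).
  move=> ij; have [s hs] := common_ratio_iterates B jm acc ij.
  by exists s => l /andP[jl lj]; apply: hs; rewrite lj (leq_trans _ jl).
have -> : averaged j - averaged j.+1
    = -1 *: combo w (co j.+1) j.+1 + combo w (co j) j.
  rewrite /averaged scaleN1r; move: (combo _ _ _) (combo _ _ _) => c q.
  by apply/matrixP => ? ?; rewrite !mxE; ring.
apply: common_ratio_lin; first exact: common_ratio_combo.
by apply: common_ratio_combo => i ij; apply: H; rewrite ltnS ltnW.
Qed.

End OneBlock.

Lemma gradient_growth v : enorm (grad f (xs + v)) <= L * enorm v.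
Proof. by have := lipg (xs + v) xs; rewrite g0 subr0 (addrC xs) addrK addrC. Qed.

Lemma gradient_model v : enorm v < r ->
  enorm (grad f (xs + v) - A *m v) <= K * enorm v ^+ 2.
Proof.
move=> vr; have := @linA 0 v; rewrite enorm0 add0r addr0 g0 subr0 => /(_ vr).
by rewrite -mulrA -expr2.
Qed.

Lemma gradient_lower v : enorm v < r -> K * enorm v <= mu / 2 ->
  mu / 2 * enorm v <= enorm (grad f (xs + v)).
Proof.
move=> vr Kv.
have h1 := gradient_model vr; have h2 := hessian_injective loA v.
have h3 := enorm_le_sub (A *m v) (grad f (xs + v)).
have h4 := ler_wpM2r (enorm_ge0 v) Kv; rewrite -mulrA -expr2 in h4.
lra.
Qed.

(** The bound M keeps each term of the combination V of displacements below M
    |V|, so the gradient combination G differs from A V by O(D) |V|.  For small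
    D this makes |G| >= mu |V| / 2; as |G| <= 2 L D by optimality, V = O(D) and
    the defect G - A V is O(D^2). *)
Lemma radius_step (C : R) : 1 <= C -> exists e C' : R, [/\ 0 < e, 1 <= C' &
  forall w co j, AA_block w co -> (j <= m)%N -> enorm (w 0%N - xs) <= e ->
    (forall i, (i <= j)%N -> enorm (w i - xs) <= C * enorm (w 0%N - xs)) ->
  [/\ enorm (w j.+1 - xs) <= C' * enorm (w 0%N - xs),
      enorm (averaged w co j) <= C' * enorm (w 0%N - xs),
      enorm (residual w co j) <= C' * enorm (w 0%N - xs) &
      enorm (residual w co j - A *m averaged w co j) <= C' * enorm (w 0%N - xs) ^+ 2]].
Proof.
move=> C1; have C0 : 0 < C by lra.
(* All points involved lie within 3 C D of xs, where the gradient differences are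
   linear up to relative error 3 K C D; M m accounts for summing at most m terms. *)
pose B := 3 * K * C * (m%:R * M).
have B0 : 0 <= B by rewrite /B; do ![apply: mulr_ge0 => //]; exact: ltW.
pose T := 4 * L / mu; have T0 : 0 <= T by rewrite /T divr_ge0 ?mulr_ge0// ltW.
pose C' := 2 * C + 2 + T + L + K + B * T.
have BT0 : 0 <= B * T by rewrite mulr_ge0.
exists (Num.min (r / (4 * C)) (mu / (2 * (B + 1)))), C'; split.
- rewrite lt_min; apply/andP; split; apply: divr_gt0 => //; apply: mulr_gt0 => //.
  by rewrite ltr_wpDl.
- by rewrite /C'; move: (ltW L0) K0; lra.
move=> w co j [ls cond step] jm; set D := enorm _.
rewrite le_min ler_pdivlMr ?mulr_gt0// => /andP[De1].
rewrite ler_pdivlMr ?mulr_gt0 ?ltr_wpDl// => De2 hC.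
have D0 : 0 <= D by exact: enorm_ge0.
have BD : B * D <= mu / 2 by move: De2 D0; lra.
pose v i := w i - xs; have wE i : w i = xs + v i by rewrite /v addrC subrK.
have vD : enorm (v 0%N) = D by [].
have CD : 3 * C * D < r.
  have [D_0|D_gt0] := eqVneq D 0; first by rewrite D_0 mulr0.
  have : 0 < C * D by rewrite mulr_gt0// lt0r D_gt0.
  by move: De1; lra.
have DCD : D <= C * D by rewrite ler_peMl.
have linw i : (i < j)%N ->
    enorm (grad f (w i.+1) - grad f (w 0%N) - A *m (w i.+1 - w 0%N))
    <= 3 * K * C * D * enorm (w i.+1 - w 0%N).
  move=> ij; pose s := w i.+1 - w 0%N.
  have hs : enorm s <= C * D + D.
    have -> : s = v i.+1 - v 0%N by rewrite /s /v opprB addrA subrK.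
    by apply: le_trans (enormB _ _) _; rewrite vD lerD2r; apply: hC.
  have h : enorm (v 0%N) + enorm s <= 3 * C * D by rewrite vD; move: hs DCD; lra.
  have := @linA (v 0%N) s (le_lt_trans h CD).
  rewrite -wE (_ : w 0%N + s = w i.+1); last by rewrite /s addrC subrK.
  move=> /le_trans; apply; rewrite ler_wpM2r ?enorm_ge0//.
  by have := ler_wpM2l K0 h; lra.
pose V := combo w (co j) j; pose G := combo (fun i => grad f (w i)) (co j) j.
have GV : enorm (G - A *m V) <= B * D * enorm V.
  rewrite /G /V /combo mulmx_sumr -sumrB.
  apply: le_trans (enorm_sum _ _ _) _.
  have hterm (i : 'I_j) : true -> enorm (co j i *: (grad f (w i.+1) - grad f (w 0%N)) -
      A *m (co j i *: (w i.+1 - w 0%N))) <= 3 * K * C * D * (M * enorm V).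
    move=> _; rewrite -scalemxAr -scalerBr enormZ.
    apply: le_trans (ler_wpM2l (normr_ge0 _) (linw i (ltn_ord i))) _.
    rewrite mulrCA ler_wpM2l ?mulr_ge0// ?(ltW C0)// mulrC.
    exact: cond.
  apply: le_trans (ler_sum _ hterm) _; rewrite sumr_const card_ord -[leLHS]mulr_natl.
  have jmR : j%:R <= m%:R :> R by rewrite ler_nat.
  have X0 : 0 <= 3 * K * C * D * (M * enorm V).
    by rewrite !mulr_ge0 ?enorm_ge0// ltW.
  apply: le_trans (ler_wpM2r X0 jmR) _.
  by rewrite le_eqVlt; apply/orP; left; apply/eqP; rewrite /B; ring.
have rho_g : enorm (residual w co j) <= L * D.
  apply: (@le_trans _ _ (enorm (grad f (w 0%N)))).
    by have := ls j (fun=> 0) jm; rewrite combo0 addr0.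
  by rewrite wE -vD gradient_growth.
have GD : enorm G <= 2 * L * D.
  have -> : G = residual w co j - grad f (w 0%N) by rewrite /residual addrC addKr.
  apply: le_trans (enormB _ _) _.
  have : enorm (grad f (w 0%N)) <= L * D by rewrite wE -vD gradient_growth.
  by move: rho_g; lra.
have VT : enorm V <= T * D.
  have h1 := hessian_injective loA V.
  have h2 := enorm_le_sub (A *m V) G.
  have h3 := ler_wpM2r (enorm_ge0 V) BD.
  have h4 : mu * enorm V <= 4 * L * D by move: h1 h2 h3 GV GD; lra.
  by rewrite /T mulrAC ler_pdivlMr// mulrC.
have avg : enorm (averaged w co j) <= (1 + T) * D.
  by apply: le_trans (enormD _ _) _; rewrite mulrDl mul1r lerD.
have C'D (c : R) : c <= C' -> forall x, x <= c * D -> x <= C' * D.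
  by move=> cC x /le_trans; apply; rewrite ler_wpM2r.
have iLL : L^-1 * (L * D) = D by rewrite mulrA mulVf ?mul1r// gt_eqF.
have nextD : enorm (w j.+1 - xs) <= (2 * C + 2 + T) * D.
  case: (step j jm) => ->.
    rewrite /accelerated -(addrA xs) (addrC xs) addrK.
    apply: le_trans (enormD _ _) _.
    rewrite enormN enormZ ger0_norm ?invr_ge0 ?(ltW L0)//.
    have := ler_wpM2l (_ : 0 <= L^-1) rho_g; rewrite invr_ge0 iLL => /(_ (ltW L0)).
    by move: avg (mulr_ge0 (ltW C0) D0); lra.
  rewrite /gstep addrAC; apply: le_trans (enormB _ _) _.
  rewrite enormZ ger0_norm ?invr_ge0 ?(ltW L0)//.
  have : enorm (grad f (w j)) <= L * (C * D).
    rewrite wE; apply: le_trans (gradient_growth _) _.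
    by rewrite ler_wpM2l ?(ltW L0)//; apply: hC.
  move=> /(ler_wpM2l (_ : 0 <= L^-1)); rewrite invr_ge0 => /(_ (ltW L0)).
  rewrite (mulrA L^-1) mulVf ?gt_eqF// mul1r.
  by have := hC j (leqnn j); move: (mulr_ge0 T0 D0); lra.
split.
- apply: C'D nextD; rewrite /C'; move: (ltW L0) K0; lra.
- apply: C'D avg; rewrite /C'; move: (ltW L0) K0; lra.
- apply: C'D rho_g; rewrite /C'; move: (ltW L0) K0; lra.
have -> : residual w co j - A *m averaged w co j
    = (grad f (xs + v 0%N) - A *m v 0%N) + (G - A *m V).
  rewrite /residual /averaged -/V -/G -wE -/(v 0%N) mulmxDr.
  by rewrite opprD addrACA.
apply: le_trans (enormD _ _) _.
have v0r : enorm (v 0%N) < r by rewrite vD; move: CD DCD; lra.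
have := gradient_model v0r; rewrite vD => h1.
have h2 : enorm (G - A *m V) <= B * T * D ^+ 2.
  apply: le_trans GV _; rewrite -mulrA; have := ler_wpM2l B0 (ler_wpM2l D0 VT).
  by rewrite expr2; lra.
have := ler_wpM2r (sqr_ge0 D) (_ : K + B * T <= C'); rewrite /C' => h3.
have {h3} := h3 ltac:(move: (ltW L0); lra); rewrite -/C'.
lra.
Qed.

(** The constants deteriorate at each step of [radius_step], but a block has
    only m + 1 steps. *)
Lemma block_bounds J : (J <= m.+1)%N -> exists e C : R, [/\ 0 < e, 1 <= C &
  forall w co, AA_block w co -> enorm (w 0%N - xs) <= e ->
  (forall j, (j <= J)%N -> enorm (w j - xs) <= C * enorm (w 0%N - xs)) /\
  (forall j, (j < J)%N ->
  [/\ enorm (averaged w co j) <= C * enorm (w 0%N - xs),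
      enorm (residual w co j) <= C * enorm (w 0%N - xs) &
      enorm (residual w co j - A *m averaged w co j) <= C * enorm (w 0%N - xs) ^+ 2])].
Proof.
elim: J => [_|J IH Jm].
  exists 1, 1; split=> // w co B _; split=> // j; rewrite leqn0 => /eqP ->.
  by rewrite mul1r.
have [e1 [C1 [e10 C11 H1]]] := IH (ltnW Jm).
have [e2 [C2 [e20 C21 H2]]] := radius_step C11.
exists (Num.min e1 e2), (C1 + C2); split; first by rewrite lt_min e10.
  by lra.
move=> w co B; rewrite le_min => /andP[De1 De2].
have [H3 H4] := H1 w co B De1.
have [H5 H6 H7 H8] := H2 w co J B Jm De2 H3.
have D0 := enorm_ge0 (w 0%N - xs).
have w1 (k : nat) (a : R) : a <= C1 * enorm (w 0%N - xs) ^+ k ->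
    a <= (C1 + C2) * enorm (w 0%N - xs) ^+ k.
  by move=> /le_trans; apply; rewrite ler_wpM2r ?exprn_ge0//; lra.
have w2 (k : nat) (a : R) : a <= C2 * enorm (w 0%N - xs) ^+ k ->
    a <= (C1 + C2) * enorm (w 0%N - xs) ^+ k.
  by move=> /le_trans; apply; rewrite ler_wpM2r ?exprn_ge0//; lra.
split=> j.
  rewrite leq_eqVlt => /orP[/eqP ->|]; first exact: (w2 1%N).
  by rewrite ltnS => jJ; apply: (w1 1%N); exact: H3.
rewrite ltnS leq_eqVlt => /orP[/eqP ->|jJ].
  by split; [exact: (w2 1%N)|exact: (w2 1%N)|exact: w2].
have [? ? ?] := H4 _ jJ.
by split; [exact: (w1 1%N)|exact: (w1 1%N)|exact: w1].
Qed.

Lemma block_descent : exists e C : R, [/\ 0 < e, 1 <= C &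
  forall w co, AA_block w co -> enorm (w 0%N - xs) <= e ->
  [/\ forall j, (j <= m.+1)%N -> enorm (w j - xs) <= C * enorm (w 0%N - xs),
      mu / 2 * enorm (w 0%N - xs) <= enorm (grad f (w 0%N)) &
      forall j, (j < m)%N -> (forall i, (i <= j)%N -> w i.+1 = accelerated w co i) ->
        f (accelerated w co j.+1) <= f (w j.+1)
          - (2 * L)^-1 * enorm (grad f (w j.+1)) ^+ 2 + C * enorm (w 0%N - xs) ^+ 3]].
Proof.
have iL0 : 0 < L^-1 by rewrite invr_gt0.
have [e1 [C1 [e10 C11 H1]]] := block_bounds (leqnn m.+1).
have [C2 C20 H2] := minres_progress L0 mu0 symA upA loA.
have [C3 C30 H3] := accelerated_step_descent L0 mu0 symA upA loA.
have C1_gt0 : 0 < C1 by lra.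
(* C1 bounds averaged points and residuals, so B bounds accelerated points. *)
pose B := C1 + C1 / L; have B0 : 0 < B by rewrite addr_gt0// divr_gt0.
have C1B : C1 <= B by rewrite lerDl ltW// divr_gt0.
pose Q := 1 + K * C1; have Q0 : 0 < Q by rewrite ltr_wpDr// mulr_ge0// ltW.
pose S := C2 * (C1 * Q * C1) + 2 * (K * B ^+ 3) + C3 * (C1 * Q * C1).
pose C := C1 + S.
have CQC0 : 0 <= C1 * Q * C1 by rewrite !mulr_ge0// ltW.
have KB0 : 0 <= K * B ^+ 3 by rewrite mulr_ge0// exprn_ge0// ltW.
have p2 := mulr_ge0 C20 CQC0; have p3 := mulr_ge0 C30 CQC0.
exists (Num.min e1 (Num.min (r / (2 * B)) (Num.min Q^-1 (mu / (2 * (K + 1)))))), C.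
split.
- rewrite !lt_min e10 invr_gt0 Q0 !divr_gt0 ?mulr_gt0//.
  by rewrite ltr_wpDl.
- by rewrite /C /S; lra.
move=> w co blk; set D := enorm _.
rewrite !le_min => /and4P[De1]; rewrite ler_pdivlMr ?mulr_gt0// => De2 De3.
rewrite ler_pdivlMr ?mulr_gt0 ?ltr_wpDl// => De4.
have D0 : 0 <= D by exact: enorm_ge0.
have [Hw Hz] := H1 w co blk De1.
have BDr : B * D < r.
  have [D_0|D_gt0] := eqVneq D 0; first by rewrite D_0 mulr0.
  have : 0 < B * D by rewrite mulr_gt0// lt0r D_gt0.
  by move: De2; lra.
have C1Dr : C1 * D < r by apply: le_lt_trans BDr; rewrite ler_wpM2r.
have D3 : 0 <= D ^+ 3 by rewrite exprn_ge0.
split.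
- move=> j jm; apply: le_trans (Hw j jm) _; rewrite ler_wpM2r// /C /S.
  lra.
- have -> : grad f (w 0%N) = grad f (xs + (w 0%N - xs)) by rewrite addrC subrK.
  apply: gradient_lower; rewrite -/D.
    by apply: le_lt_trans C1Dr; rewrite ler_peMl.
  by move: De4 D0; lra.
move=> j jm acc.
pose rho := residual w co j.+1; pose rho' := residual w co j.
pose z := averaged w co j.+1; pose z' := averaged w co j.
pose v := w j.+1 - xs; pose g := grad f (w j.+1).
have vE : v = z' - L^-1 *: rho'.
  by rewrite /v acc// /accelerated -(addrA xs) (addrC xs) addrK.
have [zb rb db] := Hz _ (ltnW jm : (j < m.+1)%N).
have [zb1 rb1 db1] := Hz _ (jm : (j.+1 < m.+1)%N).
have vb : enorm v <= C1 * D by apply: Hw; exact: ltnW.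
have gE : g = grad f (xs + v) by rewrite /g /v addrC subrK.
pose eta := C1 * Q * D ^+ 2; pose zeta := C1 * D.
have eta_zeta : eta <= zeta.
  have : Q * D <= 1.
    by rewrite mulrC -ler_pdivlMr// div1r.
  move=> /(ler_wpM2l (_ : 0 <= C1 * D)); rewrite mulr_ge0 ?(ltW C1_gt0)// => /(_ isT).
  by rewrite /eta /zeta expr2; lra.
have db_eta a : a <= C1 * D ^+ 2 -> a <= eta.
  move=> /le_trans; apply; rewrite /eta ler_wpM2r ?sqr_ge0//.
  by rewrite ler_peMr ?(ltW C1_gt0)// /Q lerDl mulr_ge0// ltW.
have gb : enorm (g - A *m v) <= eta.
  rewrite gE; apply: le_trans (gradient_model (le_lt_trans vb C1Dr)) _.
  have : enorm v ^+ 2 <= (C1 * D) ^+ 2.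
    by rewrite ler_pXn2r// ?nnegrE ?enorm_ge0// mulr_ge0// ltW.
  move=> /(ler_wpM2l K0) /le_trans; apply.
  have : 0 <= C1 * D ^+ 2 by rewrite mulr_ge0 ?sqr_ge0// ltW.
  by rewrite /eta /Q exprMn; lra.
have [s hs] := averaged_common_ratio blk jm acc.
have progress : - C2 * (eta * zeta) <= dot rho (z' - z) - L^-1 * enorm rho ^+ 2.
  apply: (H2 rho rho' z z' g s eta zeta) => //; rewrite -?vE//; try exact: db_eta.
  - by apply: hs; rewrite leqnSn leqnn.
  - by apply: hs; rewrite leqnSn leqnn.
  - exact: residual_dot_residual.
  - exact: residual_le_gradient.
have orth : dot g rho = enorm rho ^+ 2.
  by rewrite dotC; apply: (residual_dot_gradient blk jm (leqnn _)).
have lower : - (C2 * (eta * zeta)) <= dot rho (v - z).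
  rewrite -mulNr; apply: le_trans progress _.
  have rr : dot rho rho' = enorm rho ^+ 2.
    exact: (residual_dot_residual blk jm (leqnSn j)).
  have -> : v - z = (z' - z) - L^-1 *: rho' by rewrite vE [LHS]addrAC.
  by rewrite [X in _ <= X]dotBr [dot rho (_ *: _)]dotZr rr.
pose e2 := K * B ^+ 3 * D ^+ 3.
have model u : enorm u <= B * D ->
    `|f (xs + u) - f xs - 2^-1 * dot u (A *m u)| <= e2.
  move=> uB; apply: le_trans (quadA (le_lt_trans uB BDr)) _.
  rewrite /e2 -mulrA ler_wpM2l// -exprMn ler_pXn2r// ?nnegrE ?enorm_ge0//.
  by rewrite mulr_ge0// ltW.
have vB : enorm v <= B * D by apply: le_trans vb _; rewrite ler_wpM2r.
have aB : enorm (z - L^-1 *: rho) <= B * D.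
  apply: le_trans (enormB _ _) _; rewrite enormZ gtr0_norm//.
  have := ler_wpM2l (ltW iL0) rb1; rewrite -/rho -/D.
  by move: zb1; rewrite -/z -/D /B; lra.
have := H3 rho z v g (f (w j.+1) - f xs) (f (accelerated w co j.+1) - f xs)
  (C2 * (eta * zeta)) e2 eta zeta orth lower (db_eta _ db1) gb rb1 zb1 vb eta_zeta.
have -> : w j.+1 = xs + v by rewrite /v addrC subrK.
have -> : accelerated w co j.+1 = xs + (z - L^-1 *: rho) by rewrite addrA.
rewrite -gE => /(_ (model _ vB) (model _ aB)) fin.
have E : C2 * (eta * zeta) + 2 * e2 + C3 * (eta * zeta) = S * D ^+ 3.
  by rewrite /eta /zeta /e2 /S; ring.
rewrite E in fin.
have : 0 <= C1 * D ^+ 3 by rewrite mulr_ge0// ltW.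
move: fin; rewrite /C mulrDl; lra.
Qed.

End RestartBlock.

(** * Local acceptance and convergence of the globalized scheme *)

Section Globalization.
Context {R : realType} {n : nat}.

(** Forgets the type of the coefficient vector, which varies with the iteration
    counter. *)
Definition coef q (a : 'cV[R]_q) (i : nat) : R := oapp (fun o => a o 0) 0 (insub i).

Lemma coefE q (a : 'cV[R]_q) (i : 'I_q) : coef a i = a i 0.
Proof. by rewrite /coef valK. Qed.

Lemma diffmx_mulmx m (u : nat -> 'cV[R]_n) k (a : 'cV[R]_(mhat m k)) :
  Defs.diffmx m u k *m a = combo (fun i => u (k - mhat m k + i)%N) (coef a) (mhat m k).
Proof.
apply/matrixP => i o; rewrite ord1 mxE /combo summxE; apply: eq_bigr => l _.
by rewrite coefE !mxE addn0 mulrC.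
Qed.

Lemma coef_col q (b : nat -> R) (i : 'I_q) : coef (\col_(o < q) b o) i = b i.
Proof. by rewrite coefE mxE. Qed.

Lemma diffmx_mul_col m (u : nat -> 'cV[R]_n) k (b : nat -> R) :
  Defs.diffmx m u k *m (\col_(i < mhat m k) b i)
    = combo (fun i => u (k - mhat m k + i)%N) b (mhat m k).
Proof. by rewrite diffmx_mulmx; apply: eq_bigr => i _; rewrite coef_col. Qed.

Lemma comboB (u v : nat -> 'cV[R]_n) (c : R) a j :
  combo (fun i => u i - c *: v i) a j = combo u a j - c *: combo v a j.
Proof.
rewrite /combo scaler_sumr -sumrB; apply: eq_bigr => i _.
by apply/matrixP => p q; rewrite !mxE; ring.
Qed.

Lemma comboZ (u : nat -> 'cV[R]_n) (c : R) a j :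
  combo (fun i => c *: u i) a j = c *: combo u a j.
Proof.
rewrite /combo scaler_sumr; apply: eq_bigr => i _.
by rewrite -scalerBr !scalerA mulrC.
Qed.

Variables (f : 'cV[R]_n -> R) (L mu r K M : R) (m : nat).
Variables (gamma nu c1 c2 c3 : R).
Variables (x : nat -> 'cV[R]_n) (alpha : forall k, 'cV[R]_(mhat m k)).
Variables (xs : 'cV[R]_n) (A : 'M[R]_n).
Hypothesis L0 : 0 < L.
Hypothesis M0 : 0 <= M.
Hypothesis AA : globalized_AA f L x alpha gamma nu c1 c2 c3.
Hypothesis condX : forall k, mhat m k <> 0%N ->
  (cond_number ((Xmx m x k)^T *m Xmx m x k) <= (M ^+ 2)%:E)%E.

Let w l i := x (l * m.+1 + i)%N.
Let co l j := coef (alpha (l * m.+1 + j)%N).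

Lemma hresE y : hres f L y = - L^-1 *: grad f y.
Proof. by rewrite /hres /gstep addrAC subrr add0r scaleNr. Qed.

Lemma mhat_block l j : (j <= m)%N -> mhat m (l * m.+1 + j) = j.
Proof. by move=> jm; rewrite /mhat modnMDl modn_small. Qed.

Lemma xAA_accelerated l j : (j <= m)%N ->
  xAA f L x alpha (l * m.+1 + j) = accelerated f L xs (w l) (co l) j.
Proof.
move=> jm; rewrite /xAA /Gmx diffmx_mulmx -/(co l j) mhat_block// addnK.
rewrite /gstep (comboB (w l) (fun i => grad f (w l i))).
rewrite /accelerated /residual /averaged /w addn0.
move: (combo _ _ _) (combo _ _ _) => p q; rewrite scalerDr.
by apply/matrixP => ? ?; rewrite !mxE; ring.
Qed.

Lemma AA_block_iterates l : AA_block f L M m xs (w l) (co l).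
Proof.
split=> [j a jm|j a i jm ij|j jm].
- case: j jm => [|j] jm; first by rewrite /residual /combo !big_ord0.
  pose k := (l * m.+1 + j.+1)%N.
  have mk : mhat m k = j.+1 by exact: mhat_block.
  have [|ls _] := (AA k).2; first by rewrite mk.
  have := ls (\col_(i < mhat m k) a i).
  rewrite ler_pXn2r// ?nnegrE ?enorm_ge0//.
  rewrite /Hmx diffmx_mulmx diffmx_mul_col -[coef (alpha k)]/(co l j.+1) mk addnK.
  have E b : hres f L (x (l * m.+1)%N) + combo (fun i => hres f L (x (l * m.+1 + i)%N)) b j.+1
     = - L^-1 *: (grad f (w l 0%N) + combo (fun i => grad f (w l i)) b j.+1).
    rewrite scalerDr -comboZ hresE /w addn0; congr (_ + _).
    by apply: eq_bigr => i _; rewrite !hresE.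
  by rewrite !E !enormZ ler_pM2l// normr_gt0 oppr_eq0 invr_eq0 gt_eqF.
- case: j jm ij => // j jm ij; pose k := (l * m.+1 + j.+1)%N.
  have mk : mhat m k = j.+1 by exact: mhat_block.
  have ij' : (i < mhat m k)%N by rewrite mk.
  have k0 : (0 < mhat m k)%N by rewrite mk.
  have kn0 : mhat m k <> 0%N by rewrite mk.
  have H := cond_number_gram k0 (condX kn0) (Ordinal ij') (\col_o a o).
  have pk : (k - mhat m k = l * m.+1)%N by rewrite mk addnK.
  have colE : col (Ordinal ij') (Xmx m x k) = w l i.+1 - w l 0%N.
    by apply/matrixP => p o; rewrite ord1 !mxE pk /w addn0.
  have ha : `|a i| <= enorm (\col_(o < mhat m k) a o).
    by have := norm_coord_le (\col_(o < mhat m k) a o) (Ordinal ij'); rewrite mxE.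
  rewrite colE /Xmx diffmx_mul_col ger0_norm// in H.
  have := le_trans (ler_wpM2l (enorm_ge0 _) ha) H.
  by rewrite pk mk.
case: j jm => [|j] jm.
  right; rewrite /w addn0 addn1; apply: (AA _).1.
  by rewrite -[X in mhat m X]addn0 mhat_block.
rewrite -xAA_accelerated// /w addnS.
have [|_ ->] := (AA (l * m.+1 + j.+1)).2; first by rewrite mhat_block.
by case: ifP => _; [left|right].
Qed.

(** Near zero d^3 is smaller than d^nu because nu < 3, and smaller than d^2 and
    constants in any case. *)
Lemma cubic_below_threshold (C : R) : 0 < C -> 0 < c1 -> 0 < c2 -> 0 < c3 ->
  0 < nu -> nu < 3 ->
  exists2 d0 : R, 0 < d0 & forall d, 0 <= d -> d <= d0 ->
    C * d ^+ 3 <= Num.min (c1 * d `^ nu) (Num.min (c2 * d ^+ 2) c3).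
Proof.
move=> C0 c10 c20 c30 nu0 nu3.
have th0 : 0 < 3 - nu by rewrite subr_gt0.
pose e := (c1 / C) `^ (3 - nu)^-1.
have e0 : 0 < e by rewrite powR_gt0// divr_gt0.
exists (Num.min e (Num.min 1 (Num.min (c2 / C) (c3 / C)))).
  by rewrite !lt_min e0 ltr01 !divr_gt0.
move=> d d0; rewrite !le_min => /and4P[de d1].
rewrite !ler_pdivlMr// => dc2 dc3.
have d2 : d ^+ 2 <= 1 by rewrite expr_le1.
have d20 : 0 <= d ^+ 2 by exact: sqr_ge0.
apply/and3P; split.
- have [->|dn0] := eqVneq d 0; first by rewrite expr0n mulr0 powR0 ?mulr0// gt_eqF.
  have d_gt0 : 0 < d by rewrite lt0r dn0.
  have -> : d ^+ 3 = d `^ (3 - nu) * d `^ nu.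
    by rewrite -powRD ?dn0 ?implybT// subrK powR_mulrn.
  rewrite mulrA ler_wpM2r ?powR_ge0// -ler_pdivlMl// mulrC.
  have -> : c1 / C = e `^ (3 - nu).
    by rewrite /e -powRrM mulVf ?gt_eqF// powRr1// divr_ge0// ltW.
  by rewrite ge0_ler_powR// ?nnegrE ltW.
- by have := ler_wpM2r d20 dc2; rewrite -mulrA mulrCA exprS; lra.
- apply: le_trans dc3; rewrite exprS mulrA (mulrC d) ler_piMr//.
  by rewrite mulr_ge0// ltW.
Qed.

Hypothesis mu0 : 0 < mu.
Hypothesis r0 : 0 < r.
Hypothesis K0 : 0 <= K.
Hypothesis c10 : 0 < c1.
Hypothesis c20 : 0 < c2.
Hypothesis c30 : 0 < c3.
Hypothesis nu0 : 0 < nu.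
Hypothesis nu3 : nu < 3.
Hypothesis gammaL : gamma <= (2 * L)^-1.
Hypothesis lipg : lipschitz_gradient f L.
Hypothesis g0 : grad f xs = 0.
Hypothesis symA : A^T = A.
Hypothesis upA : forall v, enorm (A *m v) <= L * enorm v.
Hypothesis loA : forall v, mu * enorm v ^+ 2 <= dot v (A *m v).
Hypothesis linA : forall u v, enorm u + enorm v < r ->
  enorm (grad f (xs + u + v) - grad f (xs + u) - A *m v)
    <= K * (enorm u + enorm v) * enorm v.
Hypothesis quadA : forall v, enorm v < r ->
  `|f (xs + v) - f xs - 2^-1 * dot v (A *m v)| <= K * enorm v ^+ 3.

(** Induction along the block: acceptance of the steps before j puts
    [block_descent] at disposal for step j, whose O(D^3) error is then below the
    acceptance threshold. *)
Lemma block_acceptance : exists e C : R, [/\ 0 < e, 1 <= C &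
  forall l, enorm (w l 0 - xs) <= e ->
  [/\ forall j, (j <= m.+1)%N -> enorm (w l j - xs) <= C * enorm (w l 0 - xs),
      mu / 2 * enorm (w l 0 - xs) <= enorm (grad f (w l 0)) &
      forall j, (j < m)%N ->
        x (l * m.+1 + j.+1).+1 = xAA f L x alpha (l * m.+1 + j.+1)]].
Proof.
have [e [C [e0 C1 H]]] :=
  block_descent m L0 mu0 r0 K0 M0 lipg g0 symA upA loA linA quadA.
have C0 : 0 < C by lra.
pose C' := C * (2 / mu) ^+ 3.
have C'0 : 0 < C' by rewrite mulr_gt0// exprn_gt0// divr_gt0.
have [d0 d00 Hd] := cubic_below_threshold C'0 c10 c20 c30 nu0 nu3.
exists (Num.min e (d0 / L)), C; split => //; first by rewrite lt_min e0 divr_gt0.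
move=> l; rewrite le_min ler_pdivlMr// => /andP[De Dd].
have blk := AA_block_iterates l.
have [H1 H2 H3] := H _ _ blk De; split=> //.
have thr : C * enorm (w l 0 - xs) ^+ 3 <= Num.min (c1 * enorm (grad f (w l 0)) `^ nu)
    (Num.min (c2 * enorm (grad f (w l 0)) ^+ 2) c3).
  have dd : enorm (grad f (w l 0)) <= d0.
    apply: le_trans Dd; have -> : w l 0 = xs + (w l 0 - xs) by rewrite addrC subrK.
    apply: le_trans (gradient_growth lipg g0 _) _.
    by rewrite [xs + _]addrC subrK mulrC.
  apply: le_trans (Hd _ (enorm_ge0 _) dd).
  rewrite /C' -mulrA -exprMn ler_wpM2l ?(ltW C0)//.
  have q0 : 0 <= 2 / mu by rewrite divr_ge0// ltW.
  rewrite ler_pXn2r// ?nnegrE ?enorm_ge0 ?(mulr_ge0 q0 (enorm_ge0 _))//.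
  have := ler_wpM2l q0 H2.
  by rewrite mulrA (_ : 2 / mu * (mu / 2) = 1) ?mul1r//; field; rewrite gt_eqF.
suff acc j : (j <= m)%N -> w l j.+1 = accelerated f L xs (w l) (co l) j.
  move=> j jm; rewrite -addnS -/(w l j.+2) acc//.
  by rewrite -xAA_accelerated.
elim/ltn_ind: j => -[_ _|j IH jm].
  rewrite -xAA_accelerated// /xAA /Gmx diffmx_mulmx.
  have m0 : mhat m (l * m.+1 + 0) = 0%N by rewrite mhat_block.
  rewrite -/(co l 0) m0 /combo big_ord0 addr0 subn0 /w addn1 addn0.
  by apply: (AA _).1; rewrite -[X in mhat m X]addn0.
rewrite -xAA_accelerated//.
have [|_] := (AA (l * m.+1 + j.+1)).2; first by rewrite mhat_block.
rewrite -addnS -/(w l j.+2) => ->; rewrite ifT//.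
rewrite /AA_accept mhat_block// addnK xAA_accelerated//.
have := H3 j jm (fun i ij => IH i ij (leq_trans ij (ltnW jm))).
move=> /le_trans; apply; rewrite /w addn0 in thr *.
by apply: lerD => //; rewrite lerD2l lerN2 ler_wpM2r// sqr_ge0.
Qed.

Hypothesis df : forall z, differentiable f z.
Hypothesis growth : forall v, enorm v < r ->
  f xs + mu / 2 * enorm v ^+ 2 <= f (xs + v).
Hypothesis start_decrease : forall l, f (x (l.+1 * m.+1)%N) <= f (x (l * m.+1)%N).
Hypothesis grad0 : (fun k => enorm (grad f (x k))) @ \oo --> (0 : R).

(** The invariant [good] combines closeness of a block start with a bound on f
    there.  A block cannot leave the ball in which f grows quadratically, and f
    does not increase between block starts, so the bound on f brings the next
    start back to distance E. *)
Lemma local_convergence :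
  cluster ((fun k => x (k * m.+1)%N) @ \oo) xs ->
  (x @ \oo --> xs) /\
  (exists N : nat, forall k, (N <= k)%N -> mhat m k <> 0%N ->
      x k.+1 = xAA f L x alpha k).
Proof.
move=> clus.
have [e [C [e0 C1 H]]] := block_acceptance.
have C0 : 0 < C by lra.
(* E is small enough for a whole block to remain in the ball of radius r. *)
pose E := Num.min e (r / (2 * C)).
have E0 : 0 < E by rewrite lt_min e0 divr_gt0// mulr_gt0.
have Ee : E <= e by rewrite ge_min lexx.
have CE : C * E < r.
  have : E * (2 * C) <= r by rewrite -ler_pdivlMr ?mulr_gt0// ge_min lexx orbT.
  by have := mulr_gt0 C0 E0; lra.
have Er : E < r by apply: le_lt_trans CE; rewrite ler_peMl// ltW.
pose D l := enorm (w l 0 - xs).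
have wE l j : w l j = xs + (w l j - xs) by rewrite addrC subrK.
have start l : w l 0 = x (l * m.+1)%N by rewrite /w addn0.
have next l : w l m.+1 = w l.+1 0 by rewrite /w addn0 mulSn addnC.
pose good l := D l <= E /\ f (w l 0) - f xs <= mu / 2 * E ^+ 2.
have goodS l : good l -> good l.+1.
  move=> [DE fE]; have [H1 _ _] := H l (le_trans DE Ee).
  have fE' : f (w l.+1 0) - f xs <= mu / 2 * E ^+ 2.
    by apply: le_trans fE; rewrite lerD2r !start.
  split=> //.
  have Dr : D l.+1 < r.
    rewrite /D -next; apply: le_lt_trans (H1 _ (leqnn _)) _.
    by apply: le_lt_trans CE; rewrite ler_pM2l.
  have := growth Dr; rewrite -wE => gr.
  have mu2 : 0 < mu / 2 by rewrite divr_gt0.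
  rewrite -(@ler_pXn2r _ 2)// ?nnegrE ?enorm_ge0 ?(ltW E0)// -(ler_pM2l mu2).
  by move: gr fE'; rewrite -/(D l.+1); lra.
have [l0 gl0] : exists l0, good l0.
  (* f xs + L / 2 * d^2 is an upper bound for f on the ball of radius d, and has to
     be at most f xs + mu / 2 * E^2. *)
  pose d := Num.min E (E * Num.sqrt (mu / L)).
  have d0 : 0 < d by rewrite lt_min E0 mulr_gt0// sqrtr_gt0 divr_gt0.
  have n1 : 0 < n%:R + 1 :> R by rewrite ltr_wpDl.
  have [] := clus (range (fun k => x (k * m.+1)%N)) [set y | enorm (y - xs) < d].
  - by exists 0%N => // k _ /=; exists k.
  - apply/nbhs_ballP; exists (d / (n%:R + 1)) => /=; first exact: divr_gt0.
    move=> y; rewrite -ball_normE /= => yd.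
    apply: le_lt_trans (enorm_le_mx_norm _) _; rewrite distrC in yd.
    rewrite ltr_pdivlMr// in yd; apply: le_lt_trans yd.
    by rewrite mulrDr mulr1 mulrC lerDl.
  move=> _ [[l _ <-] /= hl]; rewrite -start in hl.
  exists l; have DE : D l <= d by exact: ltW.
  split; first by apply: le_trans DE _; rewrite ge_min lexx.
  have := gradient_quadratic_bound xs (w l 0 - xs) df lipg.
  rewrite -wE g0 dot0l subr0 => /(le_trans (ler_norm _)) /le_trans; apply.
  have hd : D l ^+ 2 <= E ^+ 2 * (mu / L).
    apply: (@le_trans _ _ ((E * Num.sqrt (mu / L)) ^+ 2)).
      rewrite ler_pXn2r// ?nnegrE ?enorm_ge0 ?mulr_ge0 ?sqrtr_ge0 ?(ltW E0)//.
      by apply: le_trans DE _; rewrite ge_min lexx orbT.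
    by rewrite exprMn sqr_sqrtr// divr_ge0// ltW.
  have := ler_wpM2l (_ : 0 <= L / 2) hd; rewrite divr_ge0 ?(ltW L0)// => /(_ isT).
  rewrite (_ : L / 2 * (E ^+ 2 * (mu / L)) = mu / 2 * E ^+ 2)//.
  by field; rewrite gt_eqF.
have good_after l : (l0 <= l)%N -> D l <= e.
  move=> ll0; apply: le_trans Ee.
  suff [] : good l by [].
  rewrite -(subnK ll0); elim: (l - l0)%N => // i IH; exact: goodS.
have decomp k : k = ((k %/ m.+1) * m.+1 + mhat m k)%N by exact: divn_eq.
have hatm k : (mhat m k <= m)%N by rewrite -ltnS ltn_pmod.
have late k : (l0 * m.+1 <= k)%N -> (l0 <= k %/ m.+1)%N by rewrite leq_divRL.
split; last first.
  exists (l0 * m.+1)%N => k /late /good_after/H[_ _ acc] /eqP.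
  move: (hatm k); rewrite {3 4}(decomp k); case: (mhat m k) => // j jm _.
  exact: acc.
apply/cvgrPdist_lt => eps eps0.
have tol : 0 < eps * (mu / 2) / C by rewrite divr_gt0// mulr_gt0// divr_gt0.
move/cvgrPdist_lt: grad0 => /(_ _ tol)[N _ HN].
exists (l0 * m.+1 + (N + m))%N => // k /= hk.
pose l := (k %/ m.+1)%N.
have l0l : (l0 <= l)%N by apply: late; apply: leq_trans hk; exact: leq_addr.
have [H1 H2 _] := H l (good_after l l0l).
have Nl : (N <= l * m.+1)%N.
  have : (N + m <= k)%N by apply: leq_trans hk; exact: leq_addl.
  rewrite {1}(decomp k) -/l => /leq_trans h.
  by rewrite -(leq_add2r m); apply: h; rewrite leq_add2l.
have := HN _ Nl; rewrite /= sub0r normrN ger0_norm ?enorm_ge0// -start => small.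
apply: le_lt_trans (mx_norm_le_enorm _) _; rewrite enormBC.
have xk : x k = w l (mhat m k) by rewrite /w -decomp.
rewrite xk; apply: le_lt_trans (H1 _ (leqW (hatm k))) _.
have := le_lt_trans H2 small; rewrite ltr_pdivlMr// => h.
rewrite -(ltr_pM2r (_ : 0 < mu / 2)); last exact: divr_gt0.
apply: le_lt_trans h; rewrite le_eqVlt; apply/orP; left; apply/eqP; ring.
Qed.

End Globalization.

Theorem theorem4p1 (R : realType) (n : nat) (f : 'cV[R]_n -> R) (L : R)
    (m : nat) (gamma nu c1 c2 c3 : R)
    (x : nat -> 'cV[R]_n) (alpha : forall k, 'cV[R]_(mhat m k)) :
  continuously_differentiable f ->
  has_lbound (range f) ->
  0 < L -> lipschitz_gradient f L ->
  (1 <= m)%N ->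
  0 < gamma -> 0 < c1 -> 0 < c3 ->
  0 < c2 -> c2 < 1 / (2 * m%:R * L) ->
  2 < nu -> nu < 3 ->
  globalized_AA f L x alpha gamma nu c1 c2 c3 ->
  ((\sum_(0 <= k <oo) (enorm (grad f (x k)) ^+ 2)%:E < +oo)%E /\
   (fun k => enorm (grad f (x k))) @ \oo --> (0 : R))
  /\
  (gamma < 1 / (2 * L) ->
   forall xs : 'cV[R]_n,
   cluster ((fun k => x (k * m.+1)%N) @ \oo) xs ->
   grad f xs = 0 ->
   forall r mu : R, 0 < r -> 0 < mu ->
   strongly_convex_on (eball xs r) f mu ->
   lipschitz_hessian_on (eball xs r) f ->
   (exists2 M : R, 0 < M &
      forall k, mhat m k <> 0%N ->
        (cond_number ((Xmx m x k)^T *m Xmx m x k) <= (M ^+ 2)%:E)%E) ->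
   (x @ \oo --> xs) /\
   (exists K : nat, forall k, (K <= k)%N -> mhat m k <> 0%N ->
      x k.+1 = xAA f L x alpha k)).
Proof.
move=> [df _] lb L0 lipg m1 gamma0 c10 c30 c20 c2m nu2 nu3 AA.
have to0 := gradient_to_0 df L0 lipg gamma0 c20 c2m m1 AA lb.
split; first by split=> //; exact: (gradient_summable df L0 lipg gamma0 c20 c2m m1 AA lb).
move=> gammaL xs clus g0 r mu r0 mu0 scf [dg [K hK]] [M M0 condX].
have lipH y z : eball xs r y -> eball xs r z ->
    opnorm (hessian f y - hessian f z) <= `|K| * enorm (y - z).
  move=> yB zB; apply: le_trans (hK y z yB zB) _.
  by rewrite ler_wpM2r ?enorm_ge0// ler_norm.
have K0 := normr_ge0 K.
apply: (@local_convergence _ _ f L mu r `|K| M m gamma nu c1 c2 c3 x alpha xs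
  (hessian f xs)) => //.
- exact: ltW.
- by apply: lt_trans nu2.
- by rewrite ltW// -[(2 * L)^-1]mul1r.
- exact: (hessian_symmetric df g0 r0 K0 dg lipH).
- exact: (hessian_upper lipg g0 r0 K0 dg lipH).
- exact: (hessian_lower df lipg g0 r0 K0 scf dg lipH).
- by move=> u v; exact: (gradient_linearization r0 K0 dg lipH).
- by move=> v; exact: (quadratic_model df g0 r0 K0 dg lipH).
- by move=> v; exact: (strong_convexity_growth df lipg g0 r0 scf).
- exact: (block_start_decrease df L0 lipg gamma0 c20 c2m m1 AA).
Qed.
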